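(* Let $(M,g)$ be a connected closed oriented Riemannian $4$-manifold. Let $h(t)$, for $t$ in an open interval containing $0$, be a smooth variation in $\Omega^0_+(\operatorname{Sym}^2(\Lambda^+))$ with $h(0)=h$, and write $\eta:=\dot h(0)\in\Omega^0(\operatorname{Sym}^2(\Lambda^+))$. Then $$\left.\frac{d}{dt}\right|_{t=0}A(h(t))=-\operatorname{ad}_h^{-1}(d_{A(h)}B_\eta).$$ Moreover, the Fréchet derivative of $\Phi$ at $h$, applied to the variation $\eta$, is $$D_h\Phi(\eta)=-(d_{A(h)}\operatorname{ad}_h^{-1}(d_{A(h)}B_\eta))^+h^{-1}-F_{A(h)}^+h^{-1}\eta h^{-1}.$$ Furthermore, if $h$ is a solution of $\Phi(h)=0$, then this reduces to $$D_h\Phi(\eta)=-(d_{A(h)}\operatorname{ad}_h^{-1}(d_{A(h)}B_\eta))^+h^{-1}-\eta h^{-1}.$$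
   Context: Everything is smooth. $\Lambda^k=\bigwedge^kT^*M$; $\Omega^k(\mathcal{E})$ is the space of smooth $\mathcal{E}$-valued $k$-forms; $\star$ is the Hodge star of $g$, acting on the ordinary form factor of bundle-valued forms; $T^\pm=\frac12(T\pm\star T)$ for a bundle-valued $2$-form $T$. The bundle $\Lambda^+\subset\Lambda^2$ of self-dual $2$-forms ($\star\sigma=\sigma$) has rank three and carries the Euclidean metric induced by $g$ (for an orthonormal co-frame, the $\theta_a\wedge\theta_b$, $a<b$, are orthonormal in $\Lambda^2$). It is oriented by declaring positive the local orthonormal frame $\Sigma_i=-(\theta_0\wedge\theta_i+\theta_j\wedge\theta_k)/\sqrt2$, $(i,j,k)$ a cyclic permutation of $(1,2,3)$, where $(\theta_0,\theta_1,\theta_2,\theta_3)$ is a local oriented orthonormal co-frame. $[-,-]$ denotes the fibrewise cross product on $\Lambda^+$ ($[\Sigma_i,\Sigma_j]=\sum_k\epsilon_{ijk}\Sigma_k$), and $\mathfrak{so}(\Lambda^+)$ is identified with $\Lambda^+$ by letting $f$ correspond to $v\mapsto[f,v]$. For $\Lambda^+$-valued forms, $[\sum\alpha_i\otimes\Sigma_i,\sum\beta_j\otimes\Sigma_j]=\sum_{i,j}\alpha_i\wedge\beta_j\otimes[\Sigma_i,\Sigma_j]$. An $\operatorname{SO}(3)$ connection $A$ on $\Lambda^+$ is a metric connection, with exterior covariant derivative $d_A$ and curvature $F_A\in\Omega^2(\Lambda^+)$ (via $\mathfrak{so}(\Lambda^+)\cong\Lambda^+$), so $d_A^2\alpha=[F_A,\alpha]$;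 for $a\in\Omega^1(\Lambda^+)$, $\nabla^{A+a}v=\nabla^Av+[a,v]$, and the derivative of a family of connections is an element of $\Omega^1(\Lambda^+)$. A $\Lambda^+$-valued self-dual $2$-form $T=\sum_{i,j}T_{ji}\Sigma_j\otimes\Sigma_i$ (first factor: ordinary form; second: coefficient) is regarded as the endomorphism $v\mapsto\sum_{i,j}T_{ji}\langle\Sigma_i,v\rangle\Sigma_j$ of $\Lambda^+$; this applies to $F_{A(h)}^+$ and to $(d_{A(h)}\operatorname{ad}_h^{-1}(d_{A(h)}B_\eta))^+$, and all products with $h^{-1}$ and $\eta$ are compositions of endomorphisms of $\Lambda^+$. $\operatorname{Sym}^2(\Lambda^+)$ is the bundle of self-adjoint endomorphisms of $\Lambda^+$, and $\Omega^0_+(\operatorname{Sym}^2(\Lambda^+))$ is the set of its smooth sections $h$ with $h>0$ (positive definite at every point). For an endomorphism field $h$ of $\Lambda^+$ (not necessarily positive), $B_h\in\Omega^2(\Lambda^+)$ is given locally by $B_h=\sum_ih(\Sigma_i)\otimes\Sigma_i$ (first factor: ordinary $2$-form; second: coefficient), for any local oriented orthonormal frame. For $h\in\Omega^0_+(\operatorname{Sym}^2(\Lambda^+))$, $\operatorname{ad}_h\colon\Omega^1(\Lambda^+)\to\Omega^3(\Lambda^+)$, $\operatorname{ad}_h(a)=[a,B_h]$, is invertible, and $A(h):=\Gamma-\operatorname{ad}_h^{-1}(d_\Gamma B_h)$, where $\Gamma$ is the connection on $\Lambda^+$ induced by the Levi--Civita connection of $g$. Then $\Phi(h)=\Phi_g(h):=F_{A(h)}^+h^{-1}-\operatorname{Id}$,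 a section of $\operatorname{Sym}^2(\Lambda^+)$, and $D_h\Phi(\eta)=\frac{d}{dt}|_{t=0}\Phi(h(t))$. *)

(* Defs.v *)
From HB Require Import structures.
From mathcomp Require Import all_boot all_order all_algebra.
From mathcomp Require Import all_classical all_reals all_analysis.

Set Implicit Arguments.
Unset Strict Implicit.
Unset Printing Implicit Defensive.

Import Order.TTheory GRing.Theory Num.Theory.
Import numFieldNormedType.Exports.

Local Open Scope classical_set_scope.
Local Open Scope ring_scope.

(* Conventions.  A tensor field is given, classically, by its components in   *)
(* every chart, the components in two overlapping charts being related by the *)
(* usual transformation law.  Components in a chart c are functions of the    *)
(* point p : M, and are only meaningful for p in the domain of c.  An ordinary*)
(* 2-form is the antisymmetric matrix of its values on coordinate vectors, so *)
(* that in components                                                         *)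
(*   (alpha /\ beta)_kl = alpha_k beta_l - alpha_l beta_k.                    *)

(* For U open in a finite-dimensional V, C_k k U f is the usual notion of a   *)
(* map of class C^k on U, expressed with iterated directional derivatives.    *)
Fixpoint C_k (R : realType) (V W : normedModType R) (k : nat) (U : set V)
    (f : V -> W) : Prop :=
  (forall x, U x -> {for x, continuous f}) /\
  (if k is k'.+1 then
     forall v : V,
       (forall x, U x -> derivable f x v) /\ C_k k' U (fun x => 'D_v f x)
   else True).

Definition smooth_on (R : realType) (V W : normedModType R) (U : set V)
    (f : V -> W) : Prop :=
  forall k, C_k k U f.

Record oriented_atlas (R : realType) (M : topologicalType) := OrientedAtlas {
  chart_idx : Type;
  dom : chart_idx -> set M;
  chart : chart_idx -> M -> 'rV[R]_4;
  param : chart_idx -> 'rV[R]_4 -> M;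
  dom_open : forall c, open (dom c);
  dom_cover : forall p, exists c, dom c p;
  img_open : forall c, open (chart c @` dom c);
  chartK : forall c p, dom c p -> param c (chart c p) = p;
  chart_continuous : forall c p, dom c p -> {for p, continuous (chart c)};
  param_continuous : forall c x, (chart c @` dom c) x ->
    {for x, continuous (param c)};
  transition_smooth : forall c c',
    smooth_on (chart c' @` (dom c `&` dom c')) (chart c \o param c');
  transition_oriented : forall c c' p, dom c p -> dom c' p ->
    0 < \det (\matrix_(k, m)
      ('D_(delta_mx 0 k : 'rV[R]_4) (chart c \o param c') (chart c' p)) 0 m)
}.

Section Calculus.
Context (R : realType) (M : topologicalType) (X : oriented_atlas R M).
Implicit Types (c : chart_idx X) (p : M).

Definition partial (W : normedModType R) c (k : 'I_4) (f : M -> W) p : W :=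
  'D_(delta_mx 0 k : 'rV[R]_4) (f \o param c) (chart c p).

Definition smooth_field (W : normedModType R) c (f : M -> W) : Prop :=
  smooth_on (chart c @` dom c) (f \o param c).

Definition smooth_family (W : normedModType R) (J : set R) c
    (f : R -> M -> W) : Prop :=
  smooth_on [set y : R^o * 'rV[R]_4 | J y.1 /\ (chart c @` dom c) y.2]
    (fun y : R^o * 'rV[R]_4 => f y.1 (param c y.2)).

(* row k, column m: the derivative of the m-th coordinate of c with respect   *)
(* to the k-th coordinate of c'                                               *)
Definition jac c c' p : 'M[R]_4 :=
  \matrix_(k, m) (partial c' k (chart c) p) 0 m.

(* the components in c' of the covariant 2-tensor with components s in c *)
Definition change c c' p (s : 'M[R]_4) : 'M[R]_4 :=
  jac c c' p *m s *m (jac c c' p)^T.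

End Calculus.

Record riemannian_metric (R : realType) (M : topologicalType)
    (X : oriented_atlas R M) := RiemannianMetric {
  gmx :> chart_idx X -> M -> 'M[R]_4;
  gmx_sym : forall c p, dom c p -> (gmx c p)^T = gmx c p;
  gmx_pos : forall c p (u : 'rV[R]_4), dom c p -> u != 0 ->
    0 < (u *m gmx c p *m u^T) 0 0;
  gmx_smooth : forall c, smooth_field c (gmx c);
  gmx_change : forall c c' p, dom c p -> dom c' p ->
    gmx c' p = change c c' p (gmx c p)
}.

Section Forms.
Context (R : realType) (M : topologicalType) (X : oriented_atlas R M).
Context (g : riemannian_metric X).
Implicit Types (c : chart_idx X) (p : M).

Definition levi_civita_symbol (k l m n : 'I_4) : R :=
  \det (\matrix_(a < 4, b < 4) ((nth k [:: k; l; m; n] a == b)%:R : R)).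

(* Hodge star on the form factor of a W-valued 2-form:                        *)
(*   1/2 sqrt(det g) eps_klmn g^ma g^nb T_ab                                  *)
Definition hodge (W : lmodType R) c p (T : 'I_4 -> 'I_4 -> W)
    (k l : 'I_4) : W :=
  \sum_(m < 4) \sum_(n < 4)
    (2^-1 * Num.sqrt (\det (g c p)) * levi_civita_symbol k l m n) *:
    \sum_(a < 4) \sum_(b < 4)
      (invmx (g c p) m a * invmx (g c p) n b) *: T a b.

Definition sd_part (W : lmodType R) c p (T : 'I_4 -> 'I_4 -> W)
    (k l : 'I_4) : W :=
  2^-1 *: (T k l + hodge c p T k l).

Definition LambdaP c p (s : 'M[R]_4) : Prop :=
  s^T = - s /\ forall k l, hodge c p (fun a b => s a b : R^o) k l = s k l.

(* 1/2 g^ka g^lb s_kl t_ab, so that the theta_a /\ theta_b, a < b, are        *)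
(* orthonormal when theta is                                                  *)
Definition ip c p (s t : 'M[R]_4) : R :=
  2^-1 * \tr (invmx (g c p) *m s *m invmx (g c p) *m t^T).

Definition smooth_section c (v : M -> 'M[R]_4) : Prop :=
  (forall p, dom c p -> LambdaP c p (v p)) /\ smooth_field c v.

(* Gamma^n_kl of the Levi-Civita connection *)
Definition christoffel c p (k l n : 'I_4) : R :=
  2^-1 * \sum_(a < 4) invmx (g c p) n a *
    ((partial c k (g c) p) l a + (partial c l (g c) p) k a
     - (partial c a (g c) p) k l).

(* A connection over the chart c is given by its covariant derivatives along  *)
(* the coordinate vector fields of c.                                         *)
Definition connection := 'I_4 -> (M -> 'M[R]_4) -> M -> 'M[R]_4.

(* the Levi-Civita connection on 2-forms, whose restriction to self-dual      *)
(* forms is Gamma                                                             *)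
Definition GammaLC c : connection := fun k (v : M -> 'M[R]_4) p =>
  \matrix_(l, m) ((partial c k v p) l m
    - \sum_(n < 4) christoffel c p k l n * v p n m
    - \sum_(n < 4) christoffel c p k m n * v p l n).

(* Exterior covariant derivatives of bundle-valued 1- and 2-forms; no         *)
(* bracket terms occur since coordinate vector fields commute.                *)
Definition dcov0 (D : connection) (v : M -> 'M[R]_4) :
    'I_4 -> M -> 'M[R]_4 :=
  fun k => D k v.

Definition dcov1 (D : connection) (a : 'I_4 -> M -> 'M[R]_4) :
    'I_4 -> 'I_4 -> M -> 'M[R]_4 :=
  fun k l p => D k (a l) p - D l (a k) p.

Definition dcov2 (D : connection) (B : 'I_4 -> 'I_4 -> M -> 'M[R]_4) :
    'I_4 -> 'I_4 -> 'I_4 -> M -> 'M[R]_4 :=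
  fun k l m p => D k (B l m) p + D l (B m k) p + D m (B k l) p.

(* v |-> \sum_(i,j) T_ji <Sigma_i, v> Sigma_j: contraction of the coefficient *)
(* factor of T with v                                                         *)
Definition form_endo c p (T : 'I_4 -> 'I_4 -> 'M[R]_4) (v : 'M[R]_4) :
    'M[R]_4 :=
  \matrix_(k, l) ip c p (T k l) v.

(* Endomorphism fields of the bundle of self-dual forms; the values outside   *)
(* that bundle are irrelevant.                                                *)
Definition endo_field := chart_idx X -> M -> 'M[R]_4 -> 'M[R]_4.

Definition is_endo (E : endo_field) : Prop :=
  (forall c p v, dom c p -> LambdaP c p v -> LambdaP c p (E c p v)) /\
  (forall c p (x : R) v w, dom c p -> LambdaP c p v -> LambdaP c p w ->
     E c p (x *: v + w) = x *: E c p v + E c p w) /\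
  (forall c c' p v, dom c p -> dom c' p -> LambdaP c p v ->
     E c' p (change c c' p v) = change c c' p (E c p v)) /\
  (forall c v, smooth_section c v -> smooth_field c (fun p => E c p (v p))).

Definition Omega0_Sym2 (E : endo_field) : Prop :=
  is_endo E /\
  (forall c p v w, dom c p -> LambdaP c p v -> LambdaP c p w ->
     ip c p (E c p v) w = ip c p v (E c p w)).

Definition Omega0_Sym2_pos (E : endo_field) : Prop :=
  Omega0_Sym2 E /\
  (forall c p v, dom c p -> LambdaP c p v -> v != 0 ->
     0 < ip c p (E c p v) v).

Definition endo_inv (E : endo_field) : endo_field := fun c p v =>
  xget 0 [set w | LambdaP c p w /\ E c p w = v].

(* A smooth family of endomorphism fields, tested on time-independent smooth  *)
(* local sections.                                                            *)
Definition smooth_variation (J : set R) (h : R -> endo_field) : Prop :=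
  forall c v, smooth_section c v ->
    smooth_family J c (fun t p => h t c p (v p)).

Definition dot0 (h : R -> endo_field) : endo_field := fun c p v =>
  'D_1 (fun t : R^o => h t c p v) 0.

End Forms.

(* A choice, over each chart, of a smooth oriented orthonormal co-frame       *)
(* theta_0, ..., theta_3 (the rows of the matrix); one exists over every chart*)
(* by the Gram-Schmidt process.                                               *)
Record coframe (R : realType) (M : topologicalType) (X : oriented_atlas R M)
    (g : riemannian_metric X) := Coframe {
  theta :> chart_idx X -> M -> 'M[R]_4;
  theta_orthonormal : forall c p, dom c p ->
    g c p = (theta c p)^T *m theta c p;
  theta_oriented : forall c p, dom c p -> 0 < \det (theta c p);
  theta_smooth : forall c, smooth_field c (theta c)
}.

Section Lambda.
Context (R : realType) (M : topologicalType) (X : oriented_atlas R M).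
Context (g : riemannian_metric X) (th : coframe g).
Implicit Types (c : chart_idx X) (p : M).

Definition wedge (a b : 'rV[R]_4) : 'M[R]_4 := a^T *m b - b^T *m a.

(* The index i : 'I_3 stands for i + 1 in {1, 2, 3}; addition in 'I_3 is      *)
(* modulo 3, so that (i, i + 1, i + 2) runs over the cyclic permutations.     *)
Definition Sigma c p (i : 'I_3) : 'M[R]_4 :=
  let e (a : 'I_4) := row a (th c p) in
  - ((Num.sqrt 2)^-1 *:
     (wedge (e ord0) (e (lift ord0 i))
      + wedge (e (lift ord0 (i + 1))) (e (lift ord0 (i + 2%:R))))).

(* the cross product for which Sigma is oriented orthonormal *)
Definition cross c p (v w : 'M[R]_4) : 'M[R]_4 :=
  \sum_(i < 3)
    (ip g c p (Sigma c p (i + 1)) v * ip g c p (Sigma c p (i + 2%:R)) w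
     - ip g c p (Sigma c p (i + 2%:R)) v * ip g c p (Sigma c p (i + 1)) w)
    *: Sigma c p i.

Definition Bform (E : endo_field X) c (k l : 'I_4) p : 'M[R]_4 :=
  \sum_(i < 3) (E c p (Sigma c p i)) k l *: Sigma c p i.

(* [a, B_E] for a a 1-form with values in self-dual forms *)
Definition ad (E : endo_field X) c p (a : 'I_4 -> 'M[R]_4)
    (k l m : 'I_4) : 'M[R]_4 :=
  cross c p (a k) (Bform E c l m p) + cross c p (a l) (Bform E c m k p)
  + cross c p (a m) (Bform E c k l p).

(* ad_h is fibrewise linear, so its inverse is taken point by point. *)
Definition ad_inv (E : endo_field X) c
    (b : 'I_4 -> 'I_4 -> 'I_4 -> M -> 'M[R]_4) : 'I_4 -> M -> 'M[R]_4 :=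
  fun k p =>
    xget (fun=> 0 : 'M[R]_4) [set a : 'I_4 -> 'M[R]_4 |
      (forall j, LambdaP g c p (a j)) /\
      (forall j l m, ad E c p a j l m = b j l m p)] k.

Definition conn_add c (D : connection R M) (a : 'I_4 -> M -> 'M[R]_4) :
    connection R M :=
  fun k v p => D k v p + cross c p (a k p) (v p).

(* F_kl is the element f of the bundle of self-dual forms such that           *)
(* (d_D d_D v)_kl = [f, v] for every smooth local section v.                  *)
Definition curvature c (D : connection R M) (k l : 'I_4) p : 'M[R]_4 :=
  xget 0 [set f | LambdaP g c p f /\
    forall v, smooth_section g c v ->
      dcov1 D (dcov0 D v) k l p = cross c p f (v p)].

Definition conn_derivative c (D : R -> connection R M)
    (b : 'I_4 -> M -> 'M[R]_4) : Prop :=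
  forall k p v, dom c p -> smooth_section g c v ->
    is_derive (0 : R^o) (1 : R^o) (fun t : R^o => D t k v p)
      (cross c p (b k p) (v p)).

Definition Aconn (E : endo_field X) c : connection R M :=
  conn_add c (GammaLC g c)
    (fun k p => - ad_inv E c (dcov2 (GammaLC g c) (Bform E c)) k p).

Definition FplusA (E : endo_field X) : endo_field X := fun c p v =>
  form_endo g c p
    (sd_part g c p (fun k l => curvature c (Aconn E c) k l p)) v.

Definition Phi (E : endo_field X) : endo_field X := fun c p v =>
  FplusA E c p (endo_inv g E c p v) - v.

Definition ad_inv_dB (h eta : endo_field X) c : 'I_4 -> M -> 'M[R]_4 :=
  ad_inv h c (dcov2 (Aconn h c) (Bform eta c)).

Definition dplus_ad_inv_dB (h eta : endo_field X) : endo_field X :=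
  fun c p v =>
    form_endo g c p (sd_part g c p
      (fun k l => dcov1 (Aconn h c) (ad_inv_dB h eta c) k l p)) v.

Definition endo_derivative (E : R -> endo_field X) (E' : endo_field X) : Prop :=
  forall c p v, dom c p -> LambdaP g c p v ->
    is_derive (0 : R^o) (1 : R^o) (fun t : R^o => E t c p v) (E' c p v).

End Lambda.

(* Main.v *)
Require Import Defs.
From HB Require Import structures.
From mathcomp Require Import all_boot all_order all_algebra.
From mathcomp Require Import all_classical all_reals all_analysis.
From mathcomp Require Import ring lra.

Set Implicit Arguments.
Unset Strict Implicit.
Unset Printing Implicit Defensive.

Import Order.TTheory GRing.Theory Num.Theory.
Import numFieldNormedType.Exports.

Local Open Scope classical_set_scope.
Local Open Scope ring_scope.

(** The statement is local: fix a chart and use the frame [Sigma] to write a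
    self-dual form as a vector of three functions.  Every tensor in the theorem
    then becomes a family of scalar functions of the time [t] and of the point.

    Connections.  A metric connection on self-dual forms is [d + [w, -]] with a
    vector-valued 1-form [w] ([frame_connection]).  For the Levi-Civita connection
    ([frame_connection_LC]) this holds because the connection form of an
    orthonormal coframe is antisymmetric and the forms [Sigma_i] have constant
    coefficients in the coframe: their covariant derivatives are commutators
    with an element of so(4), and only its self-dual part acts.  The curvature is
    then [dw + [w /\ w] / 2] ([frame_curvature]).

    Inverting ad_h.  The self-dual antisymmetric 4 x 4 matrices are the imaginary
    quaternions.  After dualizing 3-forms into vectors, the equation [[a, B_h] = b]
    reads [a_{i+1} q_{i+2} - a_{i+2} q_{i+1} = v_i], where [q_i] is the imaginary
    quaternion of [h(Sigma_i)].  Since [q_i q_i] is a scalar, and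
    [q_{i+1} q_i q_{i+2} - q_{i+2} q_i q_{i+1}] is the scalar [- 2 det h], the unique
    solution is [- (2 det h)^-1 \sum_j v_j q_i q_j] ([quat_cross_solve],
    [quat_cross_inj]).  Positivity of [h] gives [det h <> 0], and the formula shows
    that the coefficients of [A(h(t))] are smooth in [(t, x)] ([smooth_conn_coef]).

    The variation.  Put [a = Gamma - A(h)], so that [[a, B_h] = d_Gamma B_h].  This
    equation is linear in [h] for fixed [a]; differentiating it and commuting time
    and space derivatives ([derive_sym]) gives
    [[a', B_h] = d_Gamma B_eta - [a, B_eta] = d_A B_eta] ([dAcoef_eq]), hence
    [A' = - ad_h^-1 (d_A B_eta)].  Differentiating [dw + [w /\ w] / 2] gives
    [F' = d_A A'] ([curv_is_derive]), and the product rule, with the derivative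
    [- h^-1 eta h^-1] of [h^-1] ([inv_is_derive]), gives the formula for [Phi]
    ([Phi_is_derive_sdform]).  If [Phi(h) = 0], then [F^+ h^-1] is the identity of
    self-dual forms, so that it can be dropped from the last term. *)

(** * Maps of class C^k *)

Section SmoothMaps.
Context (R : realType).

Lemma C_kW (V W : normedModType R) k (U : set V) (f : V -> W) :
  C_k k.+1 U f -> C_k k U f.
Proof.
elim: k f => [|k IH] f [fc fd]; split=> // v.
by have [fv /IH fk] := fd v.
Qed.

Lemma eq_C_k (V W : normedModType R) k (U : set V) (f g : V -> W) :
  open U -> (forall x, U x -> f x = g x) -> C_k k U f -> C_k k U g.
Proof.
move=> oU; elim: k f g => [|k IH] f g fg.
all: have near_fg x : U x -> \forall y \near x, f y = g y
  by move=> Ux; apply: filterS (open_nbhs_nbhs (conj oU Ux)) => y /fg.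
all: case=> fc fd; split=> [x Ux|//].
- rewrite /prop_for /continuous_at -(fg _ Ux).
  by apply: cvg_trans (fc _ Ux); apply: near_eq_cvg (near_fg _ Ux).
- rewrite /prop_for /continuous_at -(fg _ Ux).
  by apply: cvg_trans (fc _ Ux); apply: near_eq_cvg (near_fg _ Ux).
move=> v; have [fv fk] := fd v; split.
  by move=> x Ux; apply: near_eq_derivable (near_fg _ Ux) (fv _ Ux).
by apply: IH fk => x Ux; apply: near_eq_derive (near_fg _ Ux).
Qed.

Section Scalar.
Context (V : normedModType R) (U : set V) (openU : open U).
Implicit Types f g : V -> R^o.

Lemma C_k_cst k (a : R^o) : C_k k U (fun=> a).
Proof.
elim: k a => [|k IH] a; (split; first by move=> x _; exact: cst_continuous) => // v.
split=> [x _|]; first exact: derivable_cst.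
have -> : (fun x => 'D_v (fun _ : V => a) x) = fun=> 0 :> R^o.
  by apply/funext => x; rewrite derive_cst.
exact: IH.
Qed.

Lemma C_kD k f g : C_k k U f -> C_k k U g -> C_k k U (fun x => f x + g x : R^o).
Proof.
elim: k f g => [|k IH] f g [fc fd] [gc gd]; (split;
  first by move=> x Ux; apply: continuousD; [exact: fc|exact: gc]) => // v.
have [fv fk] := fd v; have [gv gk] := gd v.
split=> [x Ux|]; first by apply: derivableD; [exact: fv|exact: gv].
apply: eq_C_k (IH _ _ fk gk) => // x Ux.
by rewrite -deriveD; [|exact: fv|exact: gv].
Qed.

Lemma C_kM k f g : C_k k U f -> C_k k U g -> C_k k U (fun x => f x * g x : R^o).
Proof.
elim: k f g => [|k IH] f g Cf Cg; have [fc fd] := Cf; have [gc gd] := Cg; (split;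
  first by move=> x Ux; apply: continuousM; [exact: fc|exact: gc]) => // v.
have [fv fk] := fd v; have [gv gk] := gd v.
split=> [x Ux|]; first by apply: derivableM; [exact: fv|exact: gv].
apply: eq_C_k (C_kD (IH _ _ (C_kW Cf) gk) (IH _ _ (C_kW Cg) fk)) => // x Ux.
exact/esym/(deriveM (fv x Ux) (gv x Ux)).
Qed.

Lemma C_kV k f : (forall x, U x -> f x != 0) ->
  C_k k U f -> C_k k U (fun x => (f x)^-1 : R^o).
Proof.
move=> f0; elim: k => [|k IH] Cf; have [fc fd] := Cf; (split;
  first by move=> x Ux; apply: continuousV; [exact: f0|exact: fc]) => // v.
have [fv fk] := fd v.
split=> [x Ux|]; first by apply: derivableV; [exact: f0|exact: fv].
have Ci := IH (C_kW Cf).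
apply: eq_C_k (C_kM (C_kM (C_k_cst _ (-1)) (C_kM Ci Ci)) fk) => // x Ux.
rewrite deriveV; [|exact: f0|exact: fv].
by rewrite expr2 invfM mulN1r.
Qed.

Lemma smooth_on_cst (a : R^o) : smooth_on U (fun=> a).
Proof. by move=> k; exact: C_k_cst. Qed.

Lemma smooth_onD f g : smooth_on U f -> smooth_on U g ->
  smooth_on U (fun x => f x + g x : R^o).
Proof. by move=> sf sg k; exact: C_kD. Qed.

Lemma smooth_onM f g : smooth_on U f -> smooth_on U g ->
  smooth_on U (fun x => f x * g x : R^o).
Proof. by move=> sf sg k; exact: C_kM. Qed.

Lemma smooth_onV f : (forall x, U x -> f x != 0) -> smooth_on U f ->
  smooth_on U (fun x => (f x)^-1 : R^o).
Proof. by move=> f0 sf k; exact: C_kV. Qed.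

End Scalar.

Lemma smooth_on_derivable (V W : normedModType R) (U : set V) (f : V -> W) v x :
  smooth_on U f -> U x -> derivable f x v.
Proof. by move=> /(_ 1)[_ /(_ v)[+ _]]; apply. Qed.

Lemma smooth_on_derive (V W : normedModType R) (U : set V) (f : V -> W) v :
  smooth_on U f -> smooth_on U (fun x => 'D_v f x).
Proof. by move=> sf k; have [_ /(_ v)[]] := sf k.+1. Qed.

Lemma smooth_on_continuous (V W : normedModType R) (U : set V) (f : V -> W) x :
  smooth_on U f -> U x -> {for x, continuous f}.
Proof. by move=> /(_ 0)[+ _]; apply. Qed.

(** An affine map [L] with linear part [L0] turns lines into lines, so the
    difference quotients of [f \o L] along [v] are literally those of [f] along
    [L0 v].  Used for the slices at fixed time or fixed point, and for the
    projection that regards a static field as a constant family. *)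
Lemma derive_affine (V' V W : normedModType R) (f : V -> W)
    (L L0 : V' -> V) x v :
  (forall (a : R) (w y : V'), L (a *: w + y) = a *: L0 w + L y) ->
  (derivable (f \o L) x v <-> derivable f (L x) (L0 v)) /\
  'D_v (f \o L) x = 'D_(L0 v) f (L x).
Proof.
move=> LE; rewrite /derivable /derive.
suff -> : (fun h => h^-1 *: ((f \o L \o shift x) (h *: v) - (f \o L) x)) =
  (fun h => h^-1 *: ((f \o shift (L x)) (h *: L0 v) - f (L x))) by [].
by apply/funext => a /=; rewrite LE.
Qed.

Lemma C_k_affine (V' V W : normedModType R) k (U' : set V') (U : set V)
    (f : V -> W) (L L0 : V' -> V) :
  open U' -> continuous L ->
  (forall (a : R) (w y : V'), L (a *: w + y) = a *: L0 w + L y) ->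
  (forall x, U' x -> U (L x)) -> C_k k U f -> C_k k U' (f \o L).
Proof.
move=> oU' Lc LE LU; elim: k f => [|k IH] f [fc fd]; (split;
  first by move=> x Ux; apply: continuous_comp; [exact: Lc|exact/fc/LU]) => // v.
have [fv fk] := fd (L0 v); split=> [x Ux|].
  by apply: (derive_affine f x v LE).1.2; exact/fv/LU.
apply: eq_C_k (IH _ fk) => // x Ux.
by rewrite (derive_affine f x v LE).2.
Qed.

Lemma smooth_on_affine (V' V W : normedModType R) (U' : set V') (U : set V)
    (f : V -> W) (L L0 : V' -> V) :
  open U' -> continuous L ->
  (forall (a : R) (w y : V'), L (a *: w + y) = a *: L0 w + L y) ->
  (forall x, U' x -> U (L x)) -> smooth_on U f -> smooth_on U' (f \o L).
Proof. by move=> oU' Lc LE LU sf k; exact: C_k_affine LE LU (sf k). Qed.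

Lemma continuous_mxP (V : normedModType R) m n (F : V -> 'M[R]_(m, n)) x :
  {for x, continuous F} <->
  forall i j, {for x, continuous (fun y => F y i j : R^o)}.
Proof.
split=> [Fc i j|Fc].
  by apply: (@continuous_comp _ _ _ F (fun A : 'M[R]_(m, n) => A i j));
    [exact: Fc|exact: coord_continuous].
apply/cvgrPdist_le => /= e e0; near=> y.
rewrite /Num.Def.normr/= mx_normrE (bigmax_le _ (ltW e0))//= => i _.
rewrite !mxE; move: i; near: y; apply: filter_forall => /= i.
by move: (Fc i.1 i.2) => /cvgrPdist_le /(_ _ e0).
Unshelve. all: by end_near. Qed.

Lemma C_k_mxP (V : normedModType R) m n k (U : set V) (F : V -> 'M[R]_(m, n)) :
  open U ->
  C_k k U F <-> forall i j, C_k k U (fun x => F x i j : R^o).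
Proof.
move=> oU; elim: k F => [|k IH] F.
  split=> [[Fc _] i j|FC]; split=> // x Ux.
    by move/continuous_mxP : (Fc x Ux).
  by apply/continuous_mxP => i j; have [+ _] := FC i j; exact.
split=> [[Fc Fd] i j|FC]; split=> [x Ux|v].
- by move/continuous_mxP : (Fc x Ux).
- have [Fv /IH Fk] := Fd v; split=> [x Ux|].
    by move/derivable_mxP : (Fv x Ux).
  apply: eq_C_k (Fk i j) => // x Ux.
  by rewrite derive_mx ?mxE//; exact: Fv.
- by apply/continuous_mxP => i j; have [+ _] := FC i j; exact.
have Fv x : U x -> derivable F x v.
  by move=> Ux; apply/derivable_mxP => i j; have [_ /(_ v)[+ _]] := FC i j; exact.
split=> //; apply/IH => i j; have [_ /(_ v)[_ Fk]] := FC i j.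
by apply: eq_C_k Fk => // x Ux; rewrite derive_mx ?mxE//; exact: Fv.
Qed.

Lemma smooth_on_mxP (V : normedModType R) m n (U : set V)
    (F : V -> 'M[R]_(m, n)) : open U ->
  smooth_on U F <-> forall i j, smooth_on U (fun x => F x i j : R^o).
Proof.
move=> oU; split=> [sF i j k|sF k]; last by apply/C_k_mxP => // i j; exact: sF.
by move/(C_k_mxP _ _ oU): (sF k).
Qed.

End SmoothMaps.

(** * Symmetry of second derivatives *)

Section MixedDerivatives.
Context (R : realType).

Lemma derive_along_line (V : normedModType R) (f : V -> R^o) u y (s : R^o) :
  derivable f (s *: u + y) u ->
  is_derive s (1 : R^o) (fun a : R^o => f (a *: u + y)) ('D_u f (s *: u + y)).
Proof.
have LE (a w z : R^o) : (a *: w + z) *: u + y = a *: (w *: u) + (z *: u + y).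
  by rewrite scalerDl scalerA addrA.
have [dL DL] := derive_affine f s (1 : R^o) LE.
by move=> df; split; [apply/dL|rewrite DL]; rewrite scale1r.
Qed.

Lemma MVT_line (V : normedModType R) (f : V -> R^o) u y (d : R) : 0 < d ->
  (forall s : R, 0 <= s <= d -> derivable f (s *: u + y) u) ->
  exists2 s : R, 0 < s < d & f (d *: u + y) - f y = 'D_u f (s *: u + y) * d.
Proof.
move=> d0 fd; pose F := (fun a : R^o => f (a *: u + y)).
have Fd (s : R) : 0 <= s <= d -> is_derive s (1 : R) F ('D_u f (s *: u + y)).
  by move=> /fd; exact: derive_along_line.
have [||s] := @MVT R F (fun s => 'D_u f (s *: u + y)) 0 d d0.
- by move=> s /[!in_itv]/= /andP[s0 sd]; apply: Fd; rewrite !ltW.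
- apply: derivable_within_continuous => s /[!in_itv]/= sd.
  exact: (@ex_derive _ _ _ _ _ _ _ (Fd s sd)).
by rewrite in_itv /= => sd; rewrite /F scale0r add0r subr0 => E; exists s.
Qed.

(** The mean value theorem in the direction [u], then in the direction [v].
    The left-hand side is symmetric in [u] and [v], the right-hand side is the
    derivative taken in a definite order. *)
Lemma mixed_difference (V : normedModType R) (U : set V) (f : V -> R^o)
    u v x (d : R) : smooth_on U f -> 0 < d ->
  (forall s t : R, 0 <= s <= d -> 0 <= t <= d -> U (s *: u + (t *: v + x))) ->
  exists st : R * R, [/\ 0 <= st.1 <= d, 0 <= st.2 <= d &
    f (d *: u + (d *: v + x)) - f (d *: u + x) - (f (d *: v + x) - f x) =
    'D_v ('D_u f) (st.1 *: u + (st.2 *: v + x)) * d * d].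
Proof.
move=> sf d0 Uxy.
have d1 : 0 <= d <= d by rewrite lexx ltW.
have d2 : (0 : R) <= 0 <= d by rewrite lexx ltW.
pose f1 y : R^o := f (d *: v + y) - f y.
have fdv y : U y -> derivable f y u by move=> Uy; exact: smooth_on_derivable Uy.
have tr y s w : d *: v + (s *: w + y) = s *: w + (d *: v + y).
  by rewrite !addrA [d *: v + _]addrC.
have D1 s : 0 <= s <= d -> is_derive (s *: u + x) u f1
    ('D_u f (d *: v + (s *: u + x)) - 'D_u f (s *: u + x)).
  move=> sd; apply: is_deriveB.
    have [dL DL] := derive_affine f (s *: u + x) u
      (fun a w y => tr y a w : d *: v + (a *: w + y) = a *: idfun w + _).
    by split; [apply/dL; rewrite tr; exact/fdv/Uxy|exact: DL].
  by apply: derivableP; apply: fdv; rewrite -[x]add0r -(scale0r v); exact: Uxy.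
have [|s sd E1] := @MVT_line _ f1 u x d d0.
  by move=> s sd; exact: (@ex_derive _ _ _ _ _ _ _ (D1 s sd)).
have sd' : 0 <= s <= d by case/andP: sd => ? ?; rewrite !ltW.
have [|t td E2] := @MVT_line _ ('D_u f) v (s *: u + x) d d0.
  move=> t td; rewrite addrCA.
  by apply: smooth_on_derivable (smooth_on_derive _ sf) (Uxy _ _ _ _).
exists (s, t); split=> //=; first by case/andP: td => ? ?; rewrite !ltW.
rewrite (addrCA (s *: u)) -E2 -(derive_val (is_derive := D1 s sd')) -E1 /f1.
by rewrite tr.
Qed.

Lemma nbhs_parallelogram (V : normedModType R) (N : set V) u v x :
  nbhs x N -> exists2 d : R, 0 < d &
    forall s t, 0 <= s <= d -> 0 <= t <= d -> N (s *: u + (t *: v + x)).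
Proof.
move=> Nx.
have cu : (fun st : R * R => st.1 *: u) @ ((0, 0) : R * R) --> 0 *: u.
  by apply: cvgZ; [exact: cvg_fst|exact: cvg_cst].
have cv : (fun st : R * R => st.2 *: v) @ ((0, 0) : R * R) --> 0 *: v.
  by apply: cvgZ; [exact: cvg_snd|exact: cvg_cst].
have cL : (fun st : R * R => st.1 *: u + (st.2 *: v + x)) @
    ((0, 0) : R * R) --> 0 *: u + (0 *: v + x).
  by apply: cvgD => //; apply: cvgD => //; exact: cvg_cst.
rewrite !scale0r !add0r in cL.
have /nbhs_ballP[d /= d0 dN] := cL N Nx.
exists (d / 2); first by rewrite divr_gt0.
move=> s t sd td; apply: (dN (s, t)).
have small a : 0 <= a <= d / 2 -> `|0 - a| < d.
  move=> /andP[a0 ad]; rewrite sub0r normrN ger0_norm//.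
  by apply: le_lt_trans ad _; rewrite ltr_pdivrMr// ltr_pMr// ltr1n.
by split; exact: small.
Qed.

Lemma continuous_eq_near (V : normedModType R) (A B : V -> R^o) x :
  {for x, continuous A} -> {for x, continuous B} ->
  (forall N, nbhs x N -> exists y z, [/\ N y, N z & A y = B z]) -> A x = B x.
Proof.
move=> Ac Bc AB; apply/eqP; rewrite -subr_eq0 -normr_le0.
apply/ler_addgt0Pl => e e0; rewrite addr0.
have e20 : 0 < e / 2 by rewrite divr_gt0.
have /cvgrPdist_le/(_ _ e20) nA := Ac; have /cvgrPdist_le/(_ _ e20) nB := Bc.
have [y [z [[Ay _] [_ Bz] ABE]]] := AB _ (filterI nA nB).
rewrite -(subrKA (A y)) (splitr e) (le_trans (ler_normD _ _))// lerD//.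
by rewrite ABE distrC.
Qed.

(** Both second derivatives are attained, at points of arbitrarily small
    parallelograms at [x], by the same mixed difference quotient; conclude by
    their continuity at [x]. *)
Lemma derive_sym (V : normedModType R) (U : set V) (f : V -> R^o) u v x :
  open U -> smooth_on U f -> U x -> 'D_v ('D_u f) x = 'D_u ('D_v f) x.
Proof.
move=> oU sf Ux.
have cD w1 w2 : {for x, continuous ('D_w1 ('D_w2 f))}.
  exact: smooth_on_continuous (smooth_on_derive _ (smooth_on_derive _ sf)) Ux.
apply: (@continuous_eq_near V ('D_v ('D_u f)) ('D_u ('D_v f))) => // N Nx.
have NU : nbhs x (N `&` U) by apply: filterI => //; exact: open_nbhs_nbhs.
have [d d0 dN] := nbhs_parallelogram u v NU.
have [d' d0' dN'] := nbhs_parallelogram v u NU.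
pose r := Num.min d d'.
have r0 : 0 < r by rewrite lt_min d0.
have rd a : 0 <= a <= r -> 0 <= a <= d /\ 0 <= a <= d'.
  by move=> /andP[a0]; rewrite le_min a0 => /andP[].
have N1 s t : 0 <= s <= r -> 0 <= t <= r -> (N `&` U) (s *: u + (t *: v + x)).
  by move=> /rd[? _] /rd[? _]; exact: dN.
have N2 s t : 0 <= s <= r -> 0 <= t <= r -> (N `&` U) (s *: v + (t *: u + x)).
  by move=> /rd[_ ?] /rd[_ ?]; exact: dN'.
have [[s t] [/= sr tr E1]] :=
  mixed_difference sf r0 (fun s t a b => (N1 s t a b).2).
have [[s' t'] [/= sr' tr' E2]] :=
  mixed_difference sf r0 (fun s t a b => (N2 s t a b).2).
exists (s *: u + (t *: v + x)), (s' *: v + (t' *: u + x)); split.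
- exact: (N1 _ _ sr tr).1.
- exact: (N2 _ _ sr' tr').1.
have diffE (a b c e : R) : a - b - (c - e) = a - c - (b - e) by ring.
move: E2; rewrite (addrCA (r *: v)) diffE => E2.
have r_neq0 := lt0r_neq0 r0.
have E3 := mulIf r_neq0 (mulIf r_neq0 (etrans (esym E1) E2)).
exact: E3.
Qed.

End MixedDerivatives.

(** * Scalar fields in a chart, and their one-parameter families *)

Section ScalarFields.
Context (R : realType) (M : topologicalType) (X : oriented_atlas R M).
Implicit Types (c : chart_idx X) (p : M) (J : set R).

Definition smooth_scalar J c (F : R -> M -> R) : Prop :=
  smooth_family (W := R^o : normedModType R) J c F.

(** Time and partial derivatives are locked: comparing two different
    derivatives by conversion would unfold limits of filters.  [pderivable] is
    an inductive type for the same reason. *)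
Fact time_der_key : unit. Proof. by []. Qed.
Definition time_der (F : R -> M -> R) : R -> M -> R :=
  locked_with time_der_key
    (fun F t p => 'D_(1 : R^o) (fun s : R^o => F s p : R^o) t) F.

Fact pder_key : unit. Proof. by []. Qed.
Definition pder c (k : 'I_4) (f : M -> R) : M -> R :=
  locked_with pder_key
    (fun f => partial (W := R^o : normedModType R) c k f) f.

Variant pderivable c (k : 'I_4) (f : M -> R) p : Prop :=
  Pderivable of derivable (W := R^o : normedModType R) (f \o param c)
    (chart c p) (delta_mx 0 k).

Lemma time_derE F t p :
  time_der F t p = 'D_(1 : R^o) (fun s : R^o => F s p : R^o) t.
Proof. by rewrite /time_der unlock. Qed.

Lemma pderE c k f p :
  pder c k f p = partial (W := R^o : normedModType R) c k f p.
Proof. by rewrite /pder unlock. Qed.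

Lemma param_dom c x : (chart c @` dom c) x -> dom c (param c x).
Proof. by move=> [p cp <-]; rewrite chartK. Qed.

Lemma eq_near_chart (W : normedModType R) c (f f' : M -> W) p :
  (forall q, dom c q -> f q = f' q) -> dom c p ->
  \forall x \near chart c p, (f \o param c) x = (f' \o param c) x.
Proof.
move=> ff' cp; have := open_nbhs_nbhs (conj (@img_open _ _ X c) (imageP _ cp)).
by apply: filterS => x /param_dom/ff'.
Qed.

Lemma eq_partial (W : normedModType R) c k (f f' : M -> W) p :
  (forall q, dom c q -> f q = f' q) -> dom c p ->
  partial c k f p = partial c k f' p.
Proof. by move=> ff' cp; exact/near_eq_derive/eq_near_chart. Qed.

Lemma eq_pder c k f f' p :
  (forall q, dom c q -> f q = f' q) -> dom c p -> pder c k f p = pder c k f' p.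
Proof. by move=> ff' cp; rewrite !pderE; exact: eq_partial. Qed.

Lemma pderivableD c k f f' p : pderivable c k f p -> pderivable c k f' p ->
  pderivable c k (fun q => f q + f' q) p.
Proof. by move=> [df] [df']; split; exact: derivableD. Qed.

Lemma pderD c k f f' p : pderivable c k f p -> pderivable c k f' p ->
  pder c k (fun q => f q + f' q) p = pder c k f p + pder c k f' p.
Proof. by move=> [df] [df']; rewrite !pderE; exact: deriveD. Qed.

Lemma pderivableN c k f p : pderivable c k f p ->
  pderivable c k (fun q => - f q) p.
Proof. by move=> [df]; split; exact: derivableN. Qed.

Lemma pderN c k f p : pderivable c k f p ->
  pder c k (fun q => - f q) p = - pder c k f p.
Proof. by move=> [df]; rewrite !pderE; exact: deriveN. Qed.

Lemma pderivableM c k f f' p : pderivable c k f p -> pderivable c k f' p ->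
  pderivable c k (fun q => f q * f' q) p.
Proof. by move=> [df] [df']; split; exact: derivableM. Qed.

Lemma pderM c k f f' p : dom c p ->
  pderivable c k f p -> pderivable c k f' p ->
  pder c k (fun q => f q * f' q) p = f p * pder c k f' p + pder c k f p * f' p.
Proof.
move=> cp [df] [df']; rewrite !pderE; apply: etrans (deriveM df df') _.
by rewrite /= chartK// [_ * f' p]mulrC.
Qed.

Lemma pderivable_cst c k a p : pderivable c k (fun=> a) p.
Proof. by split; exact: derivable_cst. Qed.

Lemma pder_cst c k a p : pder c k (fun=> a) p = 0.
Proof. by rewrite pderE; exact: derive_cst. Qed.

Lemma pder_sum_aux c k (I : Type) (s : seq I) (f : I -> M -> R) p :
  (forall i, pderivable c k (f i) p) ->
  pderivable c k (fun q => \sum_(i <- s) f i q) p /\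
  pder c k (fun q => \sum_(i <- s) f i q) p = \sum_(i <- s) pder c k (f i) p.
Proof.
move=> df; elim: s => [|i s [IH1 IH2]].
  rewrite (_ : (fun q => _) = fun=> 0); last first.
    by apply/funext => q; rewrite big_nil.
  by rewrite big_nil; split; [exact: pderivable_cst|exact: pder_cst].
rewrite (_ : (fun q => _) = fun q => f i q + \sum_(j <- s) f j q); last first.
  by apply/funext => q; rewrite big_cons.
rewrite big_cons -IH2.
by split; [exact: (pderivableD (df i) IH1)|exact: (pderD (df i) IH1)].
Qed.

Lemma pderivable_sum c k (I : Type) (s : seq I) (f : I -> M -> R) p :
  (forall i, pderivable c k (f i) p) ->
  pderivable c k (fun q => \sum_(i <- s) f i q) p.
Proof. by move=> /(pder_sum_aux s)[]. Qed.

Lemma pder_sum c k (I : Type) (s : seq I) (f : I -> M -> R) p :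
  (forall i, pderivable c k (f i) p) ->
  pder c k (fun q => \sum_(i <- s) f i q) p = \sum_(i <- s) pder c k (f i) p.
Proof. by move=> /(pder_sum_aux s)[]. Qed.

Lemma partial_mxE m n c k (F : M -> 'M[R]_(m, n)) p i j :
  (forall a b, pderivable c k (fun q => F q a b) p) ->
  partial c k F p i j = pder c k (fun q => F q i j) p.
Proof.
move=> dF; rewrite pderE /partial derive_mx ?mxE//.
by apply/derivable_mxP => a b; have [] := dF a b.
Qed.

Section Families.
Context (J : set R) (openJ : open J) (c : chart_idx X).
Implicit Types (F G : R -> M -> R).

Let W := [set y : R^o * 'rV[R]_4 | J y.1 /\ (chart c @` dom c) y.2].

Lemma open_family_dom : open W.
Proof.
apply: (@openI _ (fst @^-1` J) (snd @^-1` (chart c @` dom c))).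
  by apply: open_comp => // x _; exact: cvg_fst.
by apply: open_comp; [move=> x _; exact: cvg_snd|exact: img_open].
Qed.
Let oW := open_family_dom.

Lemma eq_smooth_scalar F G : (forall t p, J t -> dom c p -> F t p = G t p) ->
  smooth_scalar J c F -> smooth_scalar J c G.
Proof.
move=> FG sF k; apply: eq_C_k (sF k) => // -[t x] [/= Jt cx].
exact/FG/param_dom.
Qed.

Lemma smooth_scalar_cst a : smooth_scalar J c (fun _ _ => a).
Proof. exact: smooth_on_cst. Qed.

Lemma smooth_scalarD F G : smooth_scalar J c F -> smooth_scalar J c G ->
  smooth_scalar J c (fun t p => F t p + G t p).
Proof. exact: smooth_onD. Qed.

Lemma smooth_scalarM F G : smooth_scalar J c F -> smooth_scalar J c G ->
  smooth_scalar J c (fun t p => F t p * G t p).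
Proof. exact: smooth_onM. Qed.

Lemma smooth_scalarN F : smooth_scalar J c F ->
  smooth_scalar J c (fun t p => - F t p).
Proof.
move=> sF; apply: eq_smooth_scalar (smooth_scalarM (smooth_scalar_cst (-1)) sF).
by move=> t p _ _; rewrite mulN1r.
Qed.

Lemma smooth_scalarB F G : smooth_scalar J c F -> smooth_scalar J c G ->
  smooth_scalar J c (fun t p => F t p - G t p).
Proof. by move=> sF sG; exact/smooth_scalarD/smooth_scalarN. Qed.

Lemma smooth_scalarV F : (forall t p, J t -> dom c p -> F t p != 0) ->
  smooth_scalar J c F -> smooth_scalar J c (fun t p => (F t p)^-1).
Proof.
move=> F0; apply: smooth_onV => // -[t x] [/= Jt cx].
exact/F0/param_dom.
Qed.

Lemma smooth_scalar_sum (I : Type) (s : seq I) (F : I -> R -> M -> R) :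
  (forall i, smooth_scalar J c (F i)) ->
  smooth_scalar J c (fun t p => \sum_(i <- s) F i t p).
Proof.
move=> sF; elim: s => [|i s IH].
  by apply: eq_smooth_scalar (smooth_scalar_cst 0) => t p; rewrite big_nil.
by apply: eq_smooth_scalar (smooth_scalarD (sF i) IH) => t p; rewrite big_cons.
Qed.

Lemma smooth_scalar_prod (I : Type) (s : seq I) (F : I -> R -> M -> R) :
  (forall i, smooth_scalar J c (F i)) ->
  smooth_scalar J c (fun t p => \prod_(i <- s) F i t p).
Proof.
move=> sF; elim: s => [|i s IH].
  by apply: eq_smooth_scalar (smooth_scalar_cst 1) => t p; rewrite big_nil.
by apply: eq_smooth_scalar (smooth_scalarM (sF i) IH) => t p; rewrite big_cons.
Qed.

Let coord F (y : R^o * 'rV[R]_4) : R^o := F y.1 (param c y.2).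
Let e0 : R^o * 'rV[R]_4 := (1, 0).
Let e1 (k : 'I_4) : R^o * 'rV[R]_4 := (0, delta_mx 0 k).

(** A family is a map of [(t, x)]; its derivatives in time and along
    coordinates are directional derivatives along [e0] and [e1 k]. *)
Let time_affine (x : 'rV[R]_4) (a w y : R^o) :
  (a *: w + y, x) = a *: (w, (0 : 'rV[R]_4)) + (y, x).
Proof. by congr (_, _); rewrite /= scaler0 add0r. Qed.

Let space_affine (t : R^o) (a : R) (w y : 'rV[R]_4) :
  (t, a *: w + y) = a *: ((0 : R^o), w) + (t, y).
Proof. by congr (_, _); rewrite /= scaler0 add0r. Qed.

Let time_der_coord F (t : R) (x : 'rV[R]_4) :
  'D_(1 : R^o) (fun s : R^o => F s (param c x) : R^o) t =
  'D_e0 (coord F) ((t : R^o), x).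
Proof. exact: (derive_affine (coord F) t 1 (time_affine x)).2. Qed.

Let pder_coord k F (t : R) (x : 'rV[R]_4) :
  'D_(delta_mx 0 k) ((F t : M -> R^o) \o param c) x =
  'D_(e1 k) (coord F) ((t : R^o), x).
Proof. exact: (derive_affine (coord F) x _ (space_affine t)).2. Qed.

Lemma smooth_scalar_time_der F :
  smooth_scalar J c F -> smooth_scalar J c (time_der F).
Proof.
move=> sF k; apply: eq_C_k (smooth_on_derive e0 sF k) => // -[t x] _.
by rewrite time_derE; exact/esym/time_der_coord.
Qed.

Lemma smooth_scalar_pder k F :
  smooth_scalar J c F -> smooth_scalar J c (fun t => pder c k (F t)).
Proof.
move=> sF n; apply: eq_C_k (smooth_on_derive (e1 k) sF n) => //.
move=> -[t x] [/= _ [p cp <-]].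
by rewrite pderE /partial chartK//; exact/esym/pder_coord.
Qed.

Lemma smooth_scalar_is_derive F t p : smooth_scalar J c F -> J t -> dom c p ->
  is_derive (t : R^o) (1 : R^o) (fun s : R^o => F s p : R^o) (time_der F t p).
Proof.
move=> sF Jt cp; rewrite time_derE; apply: derivableP.
have := (derive_affine (coord F) t 1 (time_affine (chart c p))).1.
rewrite /comp /coord /= chartK// => ->.
by apply: smooth_on_derivable sF _; split=> //; exact: imageP.
Qed.

Lemma smooth_scalar_pderivable k F t p : smooth_scalar J c F -> J t -> dom c p ->
  pderivable c k (F t) p.
Proof.
move=> sF Jt cp; split; apply/(derive_affine (coord F) _ _ (space_affine t)).1.
by apply: smooth_on_derivable sF _; split=> //; exact: imageP.
Qed.

(** This exchange is what makes the linearization commute with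
    [d_Gamma] and with the curvature. *)
Lemma time_der_pder k F t p : smooth_scalar J c F -> J t -> dom c p ->
  time_der (fun s => pder c k (F s)) t p = pder c k (time_der F t) p.
Proof.
move=> sF Jt cp.
have Wp : W ((t : R^o), chart c p) by split=> //; exact: imageP.
have sF' : smooth_on W (coord F) by [].
have E1 : time_der (fun s => pder c k (F s)) t p =
    'D_e0 ('D_(e1 k) (coord F)) ((t : R^o), chart c p).
  rewrite time_derE (_ : (fun s : R^o => pder c k (F s) p : R^o) =
    fun s : R^o => 'D_(e1 k) (coord F) (s, chart c p)).
    exact: (derive_affine ('D_(e1 k) (coord F)) t 1 (time_affine _)).2.
  by apply/funext => s; exact: etrans (pderE _ _ _ _) (pder_coord _ _ _ _).
have E2 : pder c k (time_der F t) p =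
    'D_(e1 k) ('D_e0 (coord F)) ((t : R^o), chart c p).
  rewrite pderE /partial (_ : ((time_der F t : M -> R^o) \o param c) =
    fun x => 'D_e0 (coord F) ((t : R^o), x)).
    exact: (derive_affine ('D_e0 (coord F)) (chart c p) _ (space_affine t)).2.
  by apply/funext => x; exact: etrans (time_derE _ _ _) (time_der_coord _ _ _).
have E3 := derive_sym (e1 k) e0 oW sF' Wp.
rewrite E1 E2; exact: E3.
Qed.

Lemma pder_sym k l F t p : smooth_scalar J c F -> J t -> dom c p ->
  pder c k (pder c l (F t)) p = pder c l (pder c k (F t)) p.
Proof.
move=> sF Jt cp.
have Wp : W ((t : R^o), chart c p) by split=> //; exact: imageP.
have sF' : smooth_on W (coord F) by [].
suff E k' l' : pder c k' (pder c l' (F t)) p =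
    'D_(e1 k') ('D_(e1 l') (coord F)) ((t : R^o), chart c p).
  have E3 := derive_sym (e1 l) (e1 k) oW sF' Wp.
  by rewrite !E; exact: E3.
rewrite pderE; apply: etrans (derive_affine ('D_(e1 l') (coord F)) (chart c p) _
  (space_affine t)).2.
apply: near_eq_derive.
apply: filterS (open_nbhs_nbhs (conj (@img_open _ _ X c) (imageP _ cp))).
move=> _ [q cq <-]; rewrite /= pderE /partial chartK//; exact: pder_coord.
Qed.

Lemma smooth_scalar_field (f : M -> R) :
  smooth_field (W := R^o : normedModType R) c f -> smooth_scalar J c (fun=> f).
Proof.
apply: (smooth_on_affine (L := snd) (L0 := snd)) => //.
  by move=> x; exact: cvg_snd.
by move=> x [].
Qed.

Lemma smooth_scalar_slice F t :
  J t -> smooth_scalar J c F -> smooth_field (W := R^o : normedModType R) c (F t).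
Proof.
move=> Jt; apply: (smooth_on_affine (L := fun x : 'rV[R]_4 => ((t : R^o), x))
   (L0 := fun w => ((0 : R^o), w))).
- exact: img_open.
- move=> x; apply: (@cvg_pair _ _ _ (nbhs x) (nbhs (t : R^o)) (nbhs x)).
    exact: cvg_cst.
  exact: cvg_id.
- by move=> a w y; congr (_, _); rewrite /= scaler0 add0r.
- by move=> x Ux.
Qed.

Lemma smooth_family_mxP m n (F : R -> M -> 'M[R]_(m, n)) :
  smooth_family J c F <-> forall i j, smooth_scalar J c (fun t p => F t p i j).
Proof. exact: smooth_on_mxP. Qed.

End Families.

Lemma smooth_field_mxP m n c (F : M -> 'M[R]_(m, n)) :
  smooth_field c F <->
  forall i j, smooth_field (W := R^o : normedModType R) c (fun p => F p i j).
Proof. exact/smooth_on_mxP/img_open. Qed.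

End ScalarFields.

(** * Matrix-valued fields *)

Section MatrixFields.
Context (R : realType) (M : topologicalType) (X : oriented_atlas R M).
Implicit Types (c : chart_idx X) (p : M).

Definition pderivable_mx m n c k (A : M -> 'M[R]_(m, n)) p : Prop :=
  forall i j, pderivable c k (fun q => A q i j) p.

Lemma partial_matrixE m n c k (A : M -> 'M[R]_(m, n)) p :
  pderivable_mx c k A p ->
  partial c k A p = \matrix_(i, j) pder c k (fun q => A q i j) p.
Proof. by move=> dA; apply/matrixP => i j; rewrite partial_mxE// mxE. Qed.

Lemma pderivable_mx_cst m n c k (A : 'M[R]_(m, n)) p :
  pderivable_mx c k (fun=> A) p.
Proof. by move=> i j; exact: pderivable_cst. Qed.

Lemma partial_cst m n c k (A : 'M[R]_(m, n)) p : partial c k (fun=> A) p = 0.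
Proof.
rewrite partial_matrixE; last exact: pderivable_mx_cst.
by apply/matrixP => i j; rewrite !mxE pder_cst.
Qed.

Lemma partial_mulmx_aux m n r c k (A : M -> 'M[R]_(m, n)) (B : M -> 'M[R]_(n, r)) p :
  dom c p -> pderivable_mx c k A p -> pderivable_mx c k B p ->
  pderivable_mx c k (fun q => A q *m B q) p /\
  partial c k (fun q => A q *m B q) p =
    partial c k A p *m B p + A p *m partial c k B p.
Proof.
move=> cp dA dB.
have E i j : (fun q => (A q *m B q) i j) = fun q => \sum_l A q i l * B q l j.
  by apply/funext => q; rewrite mxE.
have dAB : pderivable_mx c k (fun q => A q *m B q) p.
  by move=> i j; rewrite E; apply: pderivable_sum => l; exact: pderivableM.
split=> //; apply/matrixP => i j; rewrite partial_mxE// E pder_sum; last first.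
  by move=> l; exact: pderivableM.
rewrite !mxE -big_split /=; apply: eq_bigr => l _.
by rewrite pderM// !partial_mxE// addrC.
Qed.

Lemma pderivable_mulmx m n r c k (A : M -> 'M[R]_(m, n)) (B : M -> 'M[R]_(n, r)) p :
  dom c p -> pderivable_mx c k A p -> pderivable_mx c k B p ->
  pderivable_mx c k (fun q => A q *m B q) p.
Proof. by move=> cp dA dB; have [] := partial_mulmx_aux cp dA dB. Qed.

Lemma partial_mulmx m n r c k (A : M -> 'M[R]_(m, n)) (B : M -> 'M[R]_(n, r)) p :
  dom c p -> pderivable_mx c k A p -> pderivable_mx c k B p ->
  partial c k (fun q => A q *m B q) p =
    partial c k A p *m B p + A p *m partial c k B p.
Proof. by move=> cp dA dB; have [] := partial_mulmx_aux cp dA dB. Qed.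

Lemma pderivable_trmx m n c k (A : M -> 'M[R]_(m, n)) p :
  pderivable_mx c k A p -> pderivable_mx c k (fun q => (A q)^T) p.
Proof.
move=> dA i j; rewrite (_ : (fun q => _) = fun q => A q j i)//.
by apply/funext => q; rewrite mxE.
Qed.

Lemma partial_trmx m n c k (A : M -> 'M[R]_(m, n)) p :
  pderivable_mx c k A p -> partial c k (fun q => (A q)^T) p = (partial c k A p)^T.
Proof.
move=> dA; apply/matrixP => i j.
rewrite partial_mxE; last exact: pderivable_trmx.
rewrite mxE partial_mxE//; congr (pder c k _ p).
by apply/funext => q; rewrite mxE.
Qed.

Lemma pderivable_mxZ m n c k (f : M -> R) (A : M -> 'M[R]_(m, n)) p :
  pderivable c k f p -> pderivable_mx c k A p ->
  pderivable_mx c k (fun q => f q *: A q) p.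
Proof.
move=> df dA i j; rewrite (_ : (fun q => _) = fun q => f q * A q i j).
  exact: (pderivableM df (dA i j)).
by apply/funext => q; rewrite mxE.
Qed.

Lemma partial_mxZ m n c k (f : M -> R) (A : M -> 'M[R]_(m, n)) p :
  dom c p -> pderivable c k f p -> pderivable_mx c k A p ->
  partial c k (fun q => f q *: A q) p =
    f p *: partial c k A p + pder c k f p *: A p.
Proof.
move=> cp df dA; apply/matrixP => i j.
rewrite partial_mxE; last exact: pderivable_mxZ.
rewrite !mxE partial_mxE// -(pderM cp df (dA i j)); congr (pder c k _ p).
by apply/funext => q; rewrite mxE.
Qed.

Lemma partial_mx_sum m n c k (I : finType) (A : I -> M -> 'M[R]_(m, n)) p :
  (forall i, pderivable_mx c k (A i) p) ->
  partial c k (fun q => \sum_i A i q) p = \sum_i partial c k (A i) p.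
Proof.
move=> dA; have E a b : (fun q => (\sum_i A i q) a b) = fun q => \sum_i A i q a b.
  by apply/funext => q; rewrite summxE.
apply/matrixP => a b; rewrite partial_mxE; last first.
  by move=> a' b'; rewrite E; apply: pderivable_sum => i; exact: dA.
rewrite E pder_sum; last by move=> i; exact: dA.
by rewrite summxE; apply: eq_bigr => i _; rewrite partial_mxE//; exact: dA.
Qed.

Section Smooth.
Context (J : set R) (openJ : open J) (c : chart_idx X).

Definition smooth_mx m n (A : R -> M -> 'M[R]_(m, n)) : Prop :=
  forall i j, smooth_scalar J c (fun t p => A t p i j).

Lemma smooth_mxM m n r (A : R -> M -> 'M[R]_(m, n)) (B : R -> M -> 'M[R]_(n, r)) :
  smooth_mx A -> smooth_mx B -> smooth_mx (fun t p => A t p *m B t p).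
Proof.
move=> sA sB i j.
rewrite (_ : (fun _ _ => _) = fun t p => \sum_l A t p i l * B t p l j).
  by apply: smooth_scalar_sum => // l; exact: smooth_scalarM.
by apply/funext => t; apply/funext => p; rewrite mxE.
Qed.

Lemma smooth_mxB m n (A B : R -> M -> 'M[R]_(m, n)) :
  smooth_mx A -> smooth_mx B -> smooth_mx (fun t p => A t p - B t p).
Proof.
move=> sA sB i j; rewrite (_ : (fun _ _ => _) = fun t p => A t p i j - B t p i j).
  exact: smooth_scalarB.
by apply/funext => t; apply/funext => p; rewrite !mxE.
Qed.

Lemma smooth_mxT m n (A : R -> M -> 'M[R]_(m, n)) :
  smooth_mx A -> smooth_mx (fun t p => (A t p)^T).
Proof.
move=> sA i j; rewrite (_ : (fun _ _ => _) = fun t p => A t p j i) //.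
by apply/funext => t; apply/funext => p; rewrite mxE.
Qed.

Lemma smooth_det n (A : R -> M -> 'M[R]_n) :
  smooth_mx A -> smooth_scalar J c (fun t p => \det (A t p)).
Proof.
move=> sA; rewrite /determinant; apply: smooth_scalar_sum => // s.
apply: smooth_scalarM => //; first exact: smooth_scalar_cst.
by apply: smooth_scalar_prod => // i; exact: sA.
Qed.

(** Cramer's rule: the entries are quotients of polynomials in the entries
    of [A]. *)
Lemma smooth_invmx n (A : R -> M -> 'M[R]_n) :
  (forall t p, J t -> dom c p -> A t p \in unitmx) ->
  smooth_mx A -> smooth_mx (fun t p => invmx (A t p)).
Proof.
move=> uA sA i j.
apply: (@eq_smooth_scalar _ _ _ _ openJ _ (fun t p =>
  (\det (A t p))^-1 * ((-1) ^+ (j + i) * \det (row' j (col' i (A t p)))))).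
  by move=> t p Jt cp; rewrite /invmx uA// !mxE.
apply: smooth_scalarM => //.
  apply: smooth_scalarV => //; last exact: smooth_det.
  by move=> t p Jt cp; rewrite -unitfE -unitmxE uA.
apply: smooth_scalarM => //; first exact: smooth_scalar_cst.
apply: smooth_det => a b; rewrite (_ : (fun _ _ => _) =
  fun t p => A t p (lift j a) (lift i b)) //.
by apply/funext => t; apply/funext => p; rewrite !mxE.
Qed.

Lemma smooth_field_mx m n (A : M -> 'M[R]_(m, n)) :
  smooth_field c A -> smooth_mx (fun=> A).
Proof.
by move=> /smooth_field_mxP sA i j; apply: smooth_scalar_field.
Qed.

Lemma smooth_mx_pderivable m n (A : R -> M -> 'M[R]_(m, n)) k t p :
  smooth_mx A -> J t -> dom c p -> pderivable_mx c k (A t) p.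
Proof.
by move=> sA Jt cp i j; exact: (smooth_scalar_pderivable k (sA i j) Jt cp).
Qed.

Lemma smooth_mx_partial m n (A : R -> M -> 'M[R]_(m, n)) k :
  smooth_mx A -> smooth_mx (fun t p => partial c k (A t) p).
Proof.
move=> sA i j; apply: (@eq_smooth_scalar _ _ _ _ openJ _ (fun t p =>
    pder c k (fun q => A t q i j) p)); last first.
  exact: (smooth_scalar_pder openJ k (sA i j)).
move=> t p Jt cp; rewrite partial_mxE//; exact: smooth_mx_pderivable.
Qed.

End Smooth.
End MatrixFields.

(** * Self-dual 4 x 4 matrices as imaginary quaternions *)

Section QuaternionAlgebra.
Context (R : realType).
Implicit Types (x y z : 'I_3 -> R).

Definition crossv x y : 'I_3 -> R := fun i =>
  x (i + 1) * y (i + 2%:R) - x (i + 2%:R) * y (i + 1).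

Definition dotv x y : R := \sum_i x i * y i.

Lemma ord3_ind (P : 'I_3 -> Prop) : P 0 -> P 1 -> P 2%:R -> forall i, P i.
Proof.
move=> P0 P1 P2 [[|[|[|//]]] lt3].
- by rewrite (_ : Ordinal lt3 = 0) //; exact: val_inj.
- by rewrite (_ : Ordinal lt3 = 1) //; exact: val_inj.
- by rewrite (_ : Ordinal lt3 = 2%:R) //; exact: val_inj.
Qed.

Lemma ord3_add : ((1 + 1 : 'I_3) = 2%:R) * ((1 + 2%:R : 'I_3) = 0) *
  ((2%:R + 1 : 'I_3) = 0) * ((2%:R + 2%:R : 'I_3) = 1).
Proof. by do !split; exact: val_inj. Qed.

Lemma sum3E (V : nmodType) (F : 'I_3 -> V) :
  \sum_i F i = F 0 + F 1 + F 2%:R.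
Proof.
rewrite !big_ord_recl big_ord0 addr0 addrA.
by congr (F _ + F _ + F _); exact: val_inj.
Qed.

Lemma sum4E (V : nmodType) (F : 'I_4 -> V) :
  \sum_i F i = F 0 + F 1 + F 2%:R + F 3%:R.
Proof.
rewrite !big_ord_recl big_ord0 addr0 !addrA.
by congr (F _ + F _ + F _ + F _); exact: val_inj.
Qed.

Lemma ord4_ind (P : 'I_4 -> Prop) :
  P 0 -> P 1 -> P 2%:R -> P 3%:R -> forall i, P i.
Proof.
move=> P0 P1 P2 P3 [[|[|[|[|//]]]] lt4].
- by rewrite (_ : Ordinal lt4 = 0) //; exact: val_inj.
- by rewrite (_ : Ordinal lt4 = 1) //; exact: val_inj.
- by rewrite (_ : Ordinal lt4 = 2%:R) //; exact: val_inj.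
- by rewrite (_ : Ordinal lt4 = 3%:R) //; exact: val_inj.
Qed.

Definition mx4 (rows : seq (seq R)) : 'M[R]_4 :=
  \matrix_(i, j) nth 0 (nth [::] rows i) j.

(** Minus the matrix of left multiplication by the imaginary quaternion with
    coordinates [x]; these are exactly the self-dual antisymmetric matrices, and
    [Sigma_i] is the image of the [i]-th one under the coframe, divided by
    [- sqrt 2]. *)
Definition quat x : 'M[R]_4 := mx4
  [:: [:: 0; x 0; x 1; x 2%:R];
      [:: - x 0; 0; x 2%:R; - x 1];
      [:: - x 1; - x 2%:R; 0; x 0];
      [:: - x 2%:R; x 1; - x 0; 0]].

(** Antisymmetrized, so that it is the Euclidean Hodge star of the
    antisymmetric part of any matrix. *)
Definition star (N : 'M[R]_4) : 'M[R]_4 :=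
  let s i j := 2^-1 * (N i j - N j i) in mx4
  [:: [:: 0; s 2%:R 3%:R; s 3%:R 1; s 1 2%:R];
      [:: s 3%:R 2%:R; 0; s 0 3%:R; s 2%:R 0];
      [:: s 1 3%:R; s 3%:R 0; 0; s 0 1];
      [:: s 2%:R 1; s 0 2%:R; s 1 0; 0]].

Lemma trmx_quat x : (quat x)^T = - quat x.
Proof.
apply/matrixP; elim/ord4_ind; elim/ord4_ind; rewrite !mxE /=; ring.
Qed.

Lemma quatZ a x : quat (fun i => a * x i) = a *: quat x.
Proof.
apply/matrixP; elim/ord4_ind; elim/ord4_ind; rewrite !mxE /=; ring.
Qed.

Lemma quatM x y :
  quat x *m quat y = (- dotv x y)%:M - quat (crossv x y).
Proof.
apply/matrixP; elim/ord4_ind; elim/ord4_ind;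
  rewrite !mxE !sum4E !mxE /= /dotv sum3E /crossv ?add0r ?ord3_add /=; ring.
Qed.

Lemma dotvC x y : dotv x y = dotv y x.
Proof. by apply: eq_bigr => i _; rewrite mulrC. Qed.

Lemma crossvC x y : crossv y x = fun i => - 1 * crossv x y i.
Proof. by apply/funext => i; rewrite /crossv; ring. Qed.

Lemma quat_sqr x : quat x *m quat x = (- dotv x x)%:M.
Proof.
have c0 : crossv x x = fun i => 0 * x i.
  by apply/funext => i; rewrite /crossv; ring.
by rewrite quatM c0 quatZ scale0r subr0.
Qed.

Lemma quat_anticomm x y :
  quat x *m quat y + quat y *m quat x = (- 2 * dotv x y)%:M.
Proof.
rewrite !quatM (dotvC y) (crossvC x) quatZ scaleN1r opprK addrACA addNr addr0.
by rewrite -raddfD /=; congr (_ %:M); ring.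
Qed.

(** For imaginary quaternions [z y x] is minus the conjugate of [x y z], so
    the difference is twice the real part of [x y z], the triple product. *)
Lemma quatM_scalar x y z :
  quat x *m quat y *m quat z - quat z *m quat y *m quat x =
  (2 * dotv x (crossv y z))%:M.
Proof.
rewrite -[quat z *m quat y *m _]mulmxA !(quatM x y) (quatM y x).
rewrite (dotvC y) (crossvC x) quatZ scaleN1r opprK.
rewrite mulmxBl mulmxDr mul_scalar_mx mul_mx_scalar opprD addrACA subrr add0r.
rewrite -opprD quat_anticomm -raddfN /=; congr (_ %:M).
rewrite /dotv !sum3E /crossv ?add0r ?ord3_add /=; ring.
Qed.

Lemma tr_quatM x y : \tr (quat x *m (quat y)^T) = 4 * dotv x y.
Proof.
rewrite trmx_quat mulmxN raddfN /= quatM raddfB /= mxtrace_scalar.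
rewrite (_ : \tr (quat _) = 0) ?subr0; last first.
  by rewrite /mxtrace sum4E !mxE /=; ring.
by rewrite mulNrn opprK mulr_natl.
Qed.

(** Self-dual and anti-self-dual matrices commute, so the commutator only
    sees the self-dual part of [W]; this is why the Levi-Civita connection
    preserves self-dual forms. *)
Lemma quat_comm (W : 'M[R]_4) x : W^T = - W ->
  quat x *m W - W *m quat x =
  quat (crossv (fun i => W 0 (lift ord0 i) +
                   W (lift ord0 (i + 1)) (lift ord0 (i + 2%:R))) x).
Proof.
move=> aW.
have Wij i j : W j i = - W i j.
  by move/matrixP/(_ i j): aW; rewrite !mxE.
have W0 i : W i i = 0 by have := Wij i i; lra.
have l0 : lift ord0 (0 : 'I_3) = 1 :> 'I_4 by exact: val_inj.
have l1 : lift ord0 (1 : 'I_3) = 2%:R :> 'I_4 by exact: val_inj.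
have l2 : lift ord0 (2%:R : 'I_3) = 3%:R :> 'I_4 by exact: val_inj.
apply/matrixP; elim/ord4_ind; elim/ord4_ind;
  rewrite !mxE !sum4E !mxE /= /crossv /= ?add0r ?ord3_add ?add0r ?l0 ?l1 ?l2
    ?(W0 0) ?(W0 1) ?(W0 2%:R) ?(W0 3%:R)
    ?(Wij 0 1) ?(Wij 0 2%:R) ?(Wij 0 3%:R) ?(Wij 1 2%:R) ?(Wij 1 3%:R)
    ?(Wij 2%:R 3%:R); ring.
Qed.

Lemma star_quat x : star (quat x) = quat x.
Proof.
apply/matrixP; elim/ord4_ind; elim/ord4_ind; rewrite !mxE /=; lra.
Qed.

End QuaternionAlgebra.

(** * The star of a 4 x 4 antisymmetric matrix *)

Section Star.
Context (R : realType).

Lemma star_fixed (N : 'M[R]_4) : N^T = - N -> star N = N ->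
  N = quat (fun i => N 0 (lift ord0 i)).
Proof.
move=> aN sN.
have Nij i j : N j i = - N i j.
  by move/matrixP/(_ i j): aN; rewrite !mxE.
have l0 : lift ord0 (0 : 'I_3) = 1 :> 'I_4 by exact: val_inj.
have l1 : lift ord0 (1 : 'I_3) = 2%:R :> 'I_4 by exact: val_inj.
have l2 : lift ord0 (2%:R : 'I_3) = 3%:R :> 'I_4 by exact: val_inj.
have E i j : star N i j = N i j by rewrite sN.
have N0 i : N i i = 0 by have := Nij i i; lra.
have := E 0 1; have := E 0 2%:R; have := E 0 3%:R.
rewrite !mxE /= (Nij 2%:R 3%:R) (Nij 1 3%:R) (Nij 1 2%:R) => E3 E2 E1.
apply/matrixP; elim/ord4_ind; elim/ord4_ind;
  rewrite !mxE /= ?l0 ?l1 ?l2 ?(N0 0) ?(N0 1) ?(N0 2%:R) ?(N0 3%:R)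
    ?(Nij 0 1) ?(Nij 0 2%:R) ?(Nij 0 3%:R) ?(Nij 1 2%:R) ?(Nij 1 3%:R)
    ?(Nij 2%:R 3%:R); lra.
Qed.

Lemma det3E (A : 'M[R]_3) :
  \det A = A 0 0 * (A 1 1 * A 2%:R 2%:R - A 1 2%:R * A 2%:R 1)
         - A 0 1 * (A 1 0 * A 2%:R 2%:R - A 1 2%:R * A 2%:R 0)
         + A 0 2%:R * (A 1 0 * A 2%:R 1 - A 1 1 * A 2%:R 0).
Proof.
rewrite (expand_det_row _ (0 : 'I_3)) sum3E /cofactor.
rewrite !(expand_det_row _ (0 : 'I_2)) !big_ord_recl !big_ord0 /cofactor.
rewrite !det_mx11 !mxE.
pose a i j := A (inord i) (inord j).
have AE i j : A i j = a i j by rewrite /a !inord_val.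
by rewrite !AE /bump /=; ring.
Qed.

Lemma det4E (A : 'M[R]_4) (D3 := fun a b c : 'I_4 =>
    A 1 a * (A 2%:R b * A 3%:R c - A 2%:R c * A 3%:R b)
    - A 1 b * (A 2%:R a * A 3%:R c - A 2%:R c * A 3%:R a)
    + A 1 c * (A 2%:R a * A 3%:R b - A 2%:R b * A 3%:R a)) :
  \det A = A 0 0 * D3 1 2%:R 3%:R - A 0 1 * D3 0 2%:R 3%:R
         + A 0 2%:R * D3 0 1 3%:R - A 0 3%:R * D3 0 1 2%:R.
Proof.
rewrite /D3 (expand_det_row _ 0) sum4E /cofactor !det3E !mxE.
pose a i j := A (inord i) (inord j).
have AE i j : A i j = a i j by rewrite /a !inord_val.
by rewrite !AE /bump /=; ring.
Qed.

Lemma starE (N : 'M[R]_4) (s := fun i j => 2^-1 * (N i j - N j i)) :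
  ((star N 0 0 = 0) * (star N 0 1 = s 2%:R 3%:R) *
   (star N 0 2%:R = s 3%:R 1) * (star N 0 3%:R = s 1 2%:R)) *
  ((star N 1 0 = s 3%:R 2%:R) * (star N 1 1 = 0) *
   (star N 1 2%:R = s 0 3%:R) * (star N 1 3%:R = s 2%:R 0)) *
  ((star N 2%:R 0 = s 1 3%:R) * (star N 2%:R 1 = s 3%:R 0) *
   (star N 2%:R 2%:R = 0) * (star N 2%:R 3%:R = s 0 1)) *
  ((star N 3%:R 0 = s 2%:R 1) * (star N 3%:R 1 = s 0 2%:R) *
   (star N 3%:R 2%:R = s 1 0) * (star N 3%:R 3%:R = 0)).
Proof. by rewrite /s; do !split; rewrite mxE. Qed.

Lemma trmx_star (N : 'M[R]_4) : (star N)^T = - star N.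
Proof.
by apply/matrixP; elim/ord4_ind; elim/ord4_ind; rewrite !mxE /=; ring.
Qed.

Lemma eq_antisym4 (A B : 'M[R]_4) : A^T = - A -> B^T = - B ->
  A 0 1 = B 0 1 -> A 0 2%:R = B 0 2%:R -> A 0 3%:R = B 0 3%:R ->
  A 1 2%:R = B 1 2%:R -> A 1 3%:R = B 1 3%:R -> A 2%:R 3%:R = B 2%:R 3%:R ->
  A = B.
Proof.
move=> aA aB E1 E2 E3 E4 E5 E6.
have Aij i j : A i j = - A j i by move/matrixP/(_ j i): aA; rewrite !mxE.
have Bij i j : B i j = - B j i by move/matrixP/(_ j i): aB; rewrite !mxE.
have A0 i : A i i = 0 by have := Aij i i; lra.
have B0 i : B i i = 0 by have := Bij i i; lra.
by apply/matrixP; elim/ord4_ind; elim/ord4_ind; rewrite ?A0 ?B0 //;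
  rewrite Aij [RHS]Bij ?(E1, E2, E3, E4, E5, E6).
Qed.

(** Jacobi's identity for complementary 2 x 2 minors of [A], in its
    contracted form: the volume form is multiplied by [\det A] under [A]. *)
Lemma star_frame (A N : 'M[R]_4) :
  A^T *m star (A *m N *m A^T) *m A = \det A *: star N.
Proof.
set P := A *m N *m A^T.
have PE c d : P c d = \sum_f (\sum_e A c e * N e f) * A d f.
  rewrite mxE; apply: eq_bigr => f _; rewrite !mxE; congr (_ * _).
have {}PE c d : P c d - P d c =
    (A c 0 * A d 1 - A c 1 * A d 0) * (N 0 1 - N 1 0)
  + (A c 0 * A d 2%:R - A c 2%:R * A d 0) * (N 0 2%:R - N 2%:R 0)
  + (A c 0 * A d 3%:R - A c 3%:R * A d 0) * (N 0 3%:R - N 3%:R 0)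
  + (A c 1 * A d 2%:R - A c 2%:R * A d 1) * (N 1 2%:R - N 2%:R 1)
  + (A c 1 * A d 3%:R - A c 3%:R * A d 1) * (N 1 3%:R - N 3%:R 1)
  + (A c 2%:R * A d 3%:R - A c 3%:R * A d 2%:R) * (N 2%:R 3%:R - N 3%:R 2%:R).
  by rewrite !PE !sum4E; ring.
have E k l : (A^T *m star P *m A) k l =
    \sum_b (\sum_a A a k * star P a b) * A b l.
  rewrite mxE; apply: eq_bigr => b _; rewrite !mxE; congr (_ * _).
  by apply: eq_bigr => a _; rewrite !mxE.
have dN k l : (\det A *: star N) k l = \det A * star N k l by rewrite mxE.
have aP : (A^T *m star P *m A)^T = - (A^T *m star P *m A).
  by rewrite !trmx_mul trmxK trmx_star mulNmx mulmxN mulmxA.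
have aN : (\det A *: star N)^T = - (\det A *: star N).
  by rewrite linearZ /= trmx_star scalerN.
move: P PE E aP => P PE E aP.
by apply: (eq_antisym4 aP aN); rewrite E dN det4E !sum4E !starE !PE; ring.
Qed.

End Star.

Section LeviCivita.
Context (R : realType).

Lemma levi_civitaE (k l m n : 'I_4) :
  levi_civita_symbol R k l m n = 2 * star (delta_mx m n) k l.
Proof.
pose d (i j : 'I_4) : R := (i == j)%:R.
have dE (i j : 'I_4) : (i == j)%:R = d i j by [].
have deltaE i j : (delta_mx m n : 'M[R]_4) i j = d m i * d n j.
  by rewrite mxE -mulnb natrM /d [i == _]eq_sym [j == _]eq_sym.
have [S SE] : exists S : 'M[R]_4, S = star (delta_mx m n)
  by exists (star (delta_mx m n)).
rewrite -SE /levi_civita_symbol det4E !mxE /= !dE {}SE.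
by move: k l; elim/ord4_ind; elim/ord4_ind; rewrite !starE ?deltaE /d /=; field.
Qed.

(** Expresses by [star] the sum over Levi-Civita symbols that defines the
    Hodge star. *)
Lemma sum_levi_civita (N : 'M[R]_4) k l :
  \sum_(m < 4) \sum_(n < 4) 2^-1 * levi_civita_symbol R k l m n * N m n
  = star N k l.
Proof.
have E m n : 2^-1 * levi_civita_symbol R k l m n * N m n =
    star (delta_mx m n) k l * N m n.
  by rewrite levi_civitaE mulrA mulVf ?mul1r.
transitivity (\sum_(m < 4) \sum_(n < 4) star (delta_mx m n) k l * N m n).
  by apply: eq_bigr => m _; apply: eq_bigr => n _.
by move: k l {E}; elim/ord4_ind; elim/ord4_ind;
  rewrite !sum4E !starE ?mxE /=; ring.
Qed.

End LeviCivita.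

(** * The equation a x q = v over the quaternions *)

Section ThreeForms.
Context (R : realType).
Implicit Types (b : 'I_4 -> 'I_4 -> 'I_4 -> R) (a : 'rV[R]_4) (S : 'M[R]_4).

Definition wedge12 a S (j l m : 'I_4) : R :=
  a 0 j * S l m + a 0 l * S m j + a 0 m * S j l.

Definition alternating3 b : Prop :=
  (forall j l m, b l j m = - b j l m) /\ (forall j l m, b j m l = - b j l m).

(** The vector dual to a 3-form in dimension 4; it determines an alternating
    form and turns [a /\ S] into the product of [a] with the star of [S]. *)
Definition dual3 b : 'rV[R]_4 :=
  \row_n nth 0 [:: - b 1 2%:R 3%:R; b 0 2%:R 3%:R; - b 0 1 3%:R; b 0 1 2%:R] n.

Lemma wedge12_alternating a S : S^T = - S -> alternating3 (wedge12 a S).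
Proof.
move=> aS; have Sij i j : S i j = - S j i.
  by move/matrixP/(_ j i): aS; rewrite !mxE.
by split=> j l m; rewrite /wedge12 (Sij j m) (Sij m l) (Sij l j); ring.
Qed.

Lemma alternating3B b b' : alternating3 b -> alternating3 b' ->
  alternating3 (fun j l m => b j l m - b' j l m).
Proof.
by move=> [b1 b2] [b1' b2']; split=> j l m;
  rewrite ?(b1 j) ?(b1' j) ?(b2 j l) ?(b2' j l); ring.
Qed.

Lemma dual3_inj b b' : alternating3 b -> alternating3 b' ->
  dual3 b = dual3 b' -> forall j l m, b j l m = b' j l m.
Proof.
move=> ab ab' E.
have En n : dual3 b 0 n = dual3 b' 0 n by rewrite E.
have := En 0; have := En 1; have := En 2%:R; have := En 3%:R.
rewrite !mxE /= => E3 E2 E1 E0 {En E}.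
pose d j l m := b j l m - b' j l m.
have [d1 d2] : alternating3 d by exact: alternating3B.
have D1 : d 1 2%:R 3%:R = 0 by rewrite /d; lra.
have D2 : d 0 2%:R 3%:R = 0 by rewrite /d; lra.
have D3 : d 0 1 3%:R = 0 by rewrite /d; lra.
have D4 : d 0 1 2%:R = 0 by rewrite /d; lra.
have dll j m : d j j m = 0 by have := d1 j j m; lra.
have dmm j m : d j m m = 0 by have := d2 j m m; lra.
have djj j m : d j m j = 0 by rewrite d2 dll oppr0.
suff d0 : forall j l m, d j l m = 0.
  by move=> j l m; have := d0 j l m; rewrite /d; lra.
have P j l m : d j l m = 0 -> [/\ d j m l = 0, d l j m = 0, d l m j = 0,
    d m j l = 0 & d m l j = 0].
  move=> E; have E' : d j m l = 0 by rewrite d2 E oppr0.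
  have E'' : d l j m = 0 by rewrite d1 E oppr0.
  have E3' : d l m j = 0 by rewrite d2 E'' oppr0.
  have E4' : d m j l = 0 by rewrite d1 E' oppr0.
  by split=> //; rewrite d2 E4' oppr0.
have [? ? ? ? ?] := P _ _ _ D1; have [? ? ? ? ?] := P _ _ _ D2.
have [? ? ? ? ?] := P _ _ _ D3; have [? ? ? ? ?] := P _ _ _ D4.
by do 3!elim/ord4_ind.
Qed.

Lemma dual3_wedge12 a S : S^T = - S -> dual3 (wedge12 a S) = a *m star S.
Proof.
move=> aS; have Sij i j : S j i = - S i j.
  by move/matrixP/(_ i j): aS; rewrite !mxE.
apply/rowP => n; rewrite [RHS]mxE; move: n.
by elim/ord4_ind; rewrite sum4E !starE mxE /wedge12 /=
  ?(Sij 0 1) ?(Sij 0 2%:R) ?(Sij 0 3%:R) ?(Sij 1 2%:R) ?(Sij 1 3%:R)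
    ?(Sij 2%:R 3%:R); field.
Qed.

End ThreeForms.

Section CrossEquation.
Context (R : realType).
Implicit Types (H : 'I_3 -> 'I_3 -> R) (a v : 'I_3 -> 'rV[R]_4).

Definition triple H : R := dotv (H 0) (crossv (H 1) (H 2%:R)).

Lemma quat_triple H i :
  quat (H (i + 1)) *m quat (H i) *m quat (H (i + 2%:R))
  - quat (H (i + 2%:R)) *m quat (H i) *m quat (H (i + 1))
  = (- 2 * triple H)%:M.
Proof.
rewrite quatM_scalar; congr (_ %:M); rewrite /triple /dotv !sum3E /crossv.
move: i; elim/ord3_ind; rewrite ?add0r ?ord3_add ?add0r; ring.
Qed.

(** Put [q_i = quat (H i)].  In [a_{i+1} q_{i+2} - a_{i+2} q_{i+1}] the
    coefficient of [v_j] is [q_{i+1} q_j q_{i+2} - q_{i+2} q_j q_{i+1}].  It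
    vanishes for [j <> i] because the squares of the [q_j] are scalars, and for
    [j = i] it is a multiple of the triple product.  Hence
    [v |-> (\sum_j v_j q_i q_j)_i] inverts [a |-> a x q] up to a scalar. *)
Lemma quat_cross_solve H v (q := fun i => quat (H i))
    (a := fun i => \sum_j v j *m (q i *m q j)) i :
  a (i + 1) *m q (i + 2%:R) - a (i + 2%:R) *m q (i + 1) =
  (- 2 * triple H) *: v i.
Proof.
rewrite /a !mulmx_suml -sumrB.
have q2 j : q j *m q j = (- dotv (H j) (H j))%:M by exact: quat_sqr.
rewrite (bigD1 i) //= (bigD1 (i + 1)) /=; last first.
  by move: i; elim/ord3_ind.
rewrite (bigD1 (i + 2%:R)) /=; last by move: i; elim/ord3_ind.
rewrite big1 ?addr0; last first.
  by move: i; do 2!elim/ord3_ind.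
rewrite -!mulmxA -!mulmxBr !mulmxA quat_triple mul_mx_scalar.
rewrite [q (i + 1) *m _]q2 mul_scalar_mx -[q (i + 2%:R) *m _ *m _]mulmxA.
rewrite [q (i + 1) *m q (i + 1)]q2 mul_mx_scalar subrr mulmx0 add0r.
rewrite -[q (i + 1) *m _ *m _]mulmxA !q2 mul_scalar_mx mul_mx_scalar subrr.
by rewrite mulmx0 addr0.
Qed.

(** The same map is a left inverse: the terms with [a (i + 1)] and
    [a (i + 2)] cancel since [q_i q_i] is central. *)
Lemma quat_cross_inj H a (q := fun i => quat (H i))
    (v := fun i => a (i + 1) *m q (i + 2%:R) - a (i + 2%:R) *m q (i + 1)) i :
  \sum_j v j *m (q i *m q j) = (- 2 * triple H) *: a i.
Proof.
have q2 j : q j *m q j = (- dotv (H j) (H j))%:M by exact: quat_sqr.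
have sum_cyc (F : 'I_3 -> 'rV[R]_4) :
    \sum_j F j = F i + F (i + 1) + F (i + 2%:R).
  rewrite sum3E; move: i; elim/ord3_ind; rewrite ?add0r ?ord3_add //.
    by rewrite [RHS]addrC addrA.
  by rewrite [LHS]addrC addrA.
have cyc : ((i + 1 + 1 = i + 2%:R) * (i + 1 + 2%:R = i) * (i + 2%:R + 1 = i) *
    (i + 2%:R + 2%:R = i + 1)).
  by clear sum_cyc; move: i; elim/ord3_ind; rewrite ?add0r ?ord3_add ?add0r ?ord3_add.
rewrite sum_cyc /v !cyc -mul_mx_scalar -(quat_triple H i).
rewrite -/(q (i + 1)) -/(q (i + 2%:R)) -/(q i) mulmxBr.
rewrite !mulmxBl !mulmxA -![_ *m q i *m q i]mulmxA !q2.
rewrite -!mulmxA ![_%:M *m _]mul_scalar_mx ?mul_mx_scalar !linearZ /=.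
by rewrite !scalerN subrKA addrC subrKA.
Qed.

End CrossEquation.

Lemma quat_deltaE (R : realType) (x : 'I_3 -> R) :
  quat x = \sum_(i < 3) x i *:
    ((delta_mx ord0 (lift ord0 i) - delta_mx (lift ord0 i) ord0) +
    (delta_mx (lift ord0 (i + 1)) (lift ord0 (i + 2%:R)) -
     delta_mx (lift ord0 (i + 2%:R)) (lift ord0 (i + 1)))).
Proof.
have l0 : lift ord0 (0 : 'I_3) = 1 :> 'I_4 by exact: val_inj.
have l1 : lift ord0 (1 : 'I_3) = 2%:R :> 'I_4 by exact: val_inj.
have l2 : lift ord0 (2%:R : 'I_3) = 3%:R :> 'I_4 by exact: val_inj.
rewrite sum3E ?add0r !ord3_add !l0 !l1 !l2 -[ord0]/(0 : 'I_4).
by apply/matrixP; elim/ord4_ind; elim/ord4_ind; rewrite !mxE /=; ring.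
Qed.

(** * The orthonormal frame of self-dual forms *)

Section Frame.
Context (R : realType) (M : topologicalType) (X : oriented_atlas R M).
Context (g : riemannian_metric X) (th : coframe g).
Implicit Types (c : chart_idx X) (p : M) (x y : 'I_3 -> R).

Definition sdform c p x : 'M[R]_4 := \sum_(i < 3) x i *: Sigma th c p i.

Definition sdcoef c p (s : 'M[R]_4) : 'I_3 -> R := fun i => ip g c p (Sigma th c p i) s.

Lemma sdformE c p x :
  sdform c p x = - (Num.sqrt 2)^-1 *: ((th c p)^T *m quat x *m th c p).
Proof.
set T := th c p.
have wedgeE a b : wedge (row a T) (row b T) =
    T^T *m (delta_mx a b - delta_mx b a) *m T.
  rewrite /wedge !rowE !trmx_mul !trmx_delta mulmxBr mulmxBl.
  rewrite -!mulmxA !(mulmxA (delta_mx _ _) (delta_mx _ _)) !mul_delta_mx.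
  by rewrite !mulmxA.
have SE i : Sigma th c p i = - (Num.sqrt 2)^-1 *: (T^T *m
    ((delta_mx ord0 (lift ord0 i) - delta_mx (lift ord0 i) ord0) +
    (delta_mx (lift ord0 (i + 1)) (lift ord0 (i + 2%:R)) -
     delta_mx (lift ord0 (i + 2%:R)) (lift ord0 (i + 1)))) *m T).
  by rewrite /Sigma -/T !wedgeE -mulmxDl -mulmxDr scaleNr.
rewrite quat_deltaE mulmx_sumr mulmx_suml scaler_sumr; apply: eq_bigr => i _.
by rewrite SE -scalemxAr -scalemxAl !scalerA mulrC.
Qed.

Lemma sdformD c p x y : sdform c p (fun i => x i + y i) = sdform c p x + sdform c p y.
Proof. by rewrite -big_split; apply: eq_bigr => i _; rewrite scalerDl. Qed.

Lemma sdformZ c p a x : sdform c p (fun i => a * x i) = a *: sdform c p x.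
Proof. by rewrite scaler_sumr; apply: eq_bigr => i _; rewrite scalerA. Qed.

Lemma sdformN c p x : sdform c p (fun i => - x i) = - sdform c p x.
Proof. by rewrite -sumrN; apply: eq_bigr => i _; rewrite scaleNr. Qed.

Lemma sdformB c p x y : sdform c p (fun i => x i - y i) = sdform c p x - sdform c p y.
Proof. by rewrite sdformD sdformN. Qed.

Lemma Sigma_sdform c p i : Sigma th c p i = sdform c p (fun j => (j == i)%:R).
Proof.
rewrite /sdform (bigD1 i) //= eqxx scale1r big1 ?addr0// => j /negbTE ->.
by rewrite scale0r.
Qed.

Lemma trmx_sdform c p x : (sdform c p x)^T = - sdform c p x.
Proof.
rewrite sdformE linearZ /= !trmx_mul trmxK trmx_quat mulNmx mulmxN mulmxA.
by rewrite scalerN.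
Qed.

Lemma sqrt2_sqr : ((Num.sqrt 2 : R)^-1) ^+ 2 = 2^-1.
Proof. by rewrite exprVn sqr_sqrtr. Qed.

Section AtPoint.
Context (c : chart_idx X) (p : M) (cp : dom c p).
Let T := th c p.

Lemma theta_unit : T \in unitmx.
Proof. by rewrite unitmxE unitfE gt_eqF// theta_oriented. Qed.
Let uT := theta_unit.

Lemma invmx_gE : invmx (g c p) = invmx T *m (invmx T)^T.
Proof.
have uTt : T^T \in unitmx by rewrite unitmx_tr.
have gT : g c p = T^T *m T by exact: theta_orthonormal.
have ug : g c p \in unitmx by rewrite gT unitmx_mul uTt.
have E : invmx T *m (invmx T)^T *m g c p = 1%:M.
  by rewrite trmx_inv gT -mulmxA (mulmxA (invmx T^T)) mulVmx// mul1mx mulVmx.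
by rewrite -[LHS]mul1mx -E -mulmxA mulmxV// mulmx1.
Qed.

Lemma sqrt_det_g : Num.sqrt (\det (g c p)) = \det T.
Proof.
have -> : g c p = T^T *m T by exact: theta_orthonormal.
by rewrite det_mulmx det_tr -expr2 sqrtr_sqr gtr0_norm// theta_oriented.
Qed.

Lemma ip_sdform x y : ip g c p (sdform c p x) (sdform c p y) = dotv x y.
Proof.
have uTt : T^T \in unitmx by rewrite unitmx_tr.
rewrite /ip !sdformE -/T invmx_gE trmx_inv [(_ *: _)^T]linearZ /=.
rewrite -!scalemxAr -!scalemxAl scalerA linearZ /= !trmx_mul trmxK.
rewrite -!mulmxA !(mulmxA (invmx T^T) T^T) mulVmx// !mul1mx.
rewrite !(mulmxA T (invmx T)) mulmxV// mul1mx mxtrace_mulC -!mulmxA mulmxV//.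
by rewrite mulmx1 tr_quatM mulrNN -expr2 sqrt2_sqr; field.
Qed.

(** In an orthonormal coframe the Hodge star is the Euclidean one: the
    coframe matrix contributes its determinant, which is [sqrt (det g)]. *)
Lemma hodge_sdform (N : 'M[R]_4) k l :
  hodge g c p (fun a b => (T^T *m N *m T) a b : R^o) k l =
  (T^T *m star N *m T) k l.
Proof.
have uTt : T^T \in unitmx by rewrite unitmx_tr.
pose P := invmx (g c p) *m (T^T *m N *m T) *m (invmx (g c p))^T.
have PE : P = invmx T *m N *m (invmx T)^T.
  rewrite /P invmx_gE trmx_mul trmxK trmx_inv -!mulmxA.
  rewrite (mulmxA (invmx T^T) T^T) mulVmx// mul1mx.
  by rewrite (mulmxA T (invmx T)) mulmxV// mul1mx.
have -> : T^T *m star N *m T = \det T *: star P.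
  have := star_frame (invmx T) N; rewrite -PE => E.
  have -> : star N = \det T *: ((invmx T)^T *m star P *m invmx T).
    by rewrite E scalerA -det_mulmx mulmxV// det1 scale1r.
  rewrite -scalemxAr -scalemxAl trmx_inv -!mulmxA.
  by rewrite mulVmx// mulmx1 !mulmxA mulmxV// mul1mx.
rewrite mxE -sum_levi_civita mulr_sumr; apply: eq_bigr => m _.
rewrite mulr_sumr; apply: eq_bigr => n _.
have -> : P m n = \sum_(a < 4) \sum_(b < 4)
    (invmx (g c p) m a * invmx (g c p) n b) * (T^T *m N *m T) a b.
  rewrite mxE exchange_big /=; apply: eq_bigr => b _.
  rewrite mxE mulr_suml; apply: eq_bigr => a _; rewrite [_^T b n]mxE; ring.
rewrite sqrt_det_g; set s := \sum_(a < 4) _.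
have -> : forall r : R, r *: (s : R^o) = r * s by [].
by ring.
Qed.

Lemma LambdaP_sdform x : LambdaP g c p (sdform c p x).
Proof.
split; first exact: trmx_sdform.
by move=> k l; rewrite sdformE scalemxAl scalemxAr hodge_sdform -quatZ star_quat.
Qed.

Lemma sdcoef_sdform x : sdcoef c p (sdform c p x) = x.
Proof.
apply/funext => i; rewrite /sdcoef Sigma_sdform ip_sdform /dotv (bigD1 i)//= eqxx mul1r.
by rewrite big1 ?addr0// => j /negbTE ->; rewrite mul0r.
Qed.

Lemma LambdaP_sdformE s : LambdaP g c p s -> s = sdform c p (sdcoef c p s).
Proof.
move=> [antis hs]; have uTt : T^T \in unitmx by rewrite unitmx_tr.
pose N := invmx T^T *m s *m invmx T.
have sE : s = T^T *m N *m T.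
  by rewrite /N !mulmxA mulmxV// mul1mx -mulmxA mulVmx// mulmx1.
have aN : N^T = - N.
  by rewrite /N !trmx_mul antis -!trmx_inv trmxK mulNmx mulmxN mulmxA trmx_inv.
have sN : star N = N.
  have : T^T *m star N *m T = s.
    by apply/matrixP => k l; rewrite -hodge_sdform -sE hs.
  rewrite sE => /(congr1 (fun A => invmx T^T *m A *m invmx T)).
  rewrite -!mulmxA mulmxV// !mulmx1 !(mulmxA (invmx T^T)) mulVmx//.
  by rewrite !mul1mx.
pose x i := - Num.sqrt 2 * N 0 (lift ord0 i).
have sx : s = sdform c p x.
  rewrite sdformE quatZ -(star_fixed aN sN) -scalemxAr -scalemxAl scalerA.
  by rewrite mulrNN mulVf ?scale1r// gt_eqF// sqrtr_gt0.
by rewrite [in RHS]sx sdcoef_sdform.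
Qed.

Lemma sdform_inj x y : sdform c p x = sdform c p y -> x = y.
Proof. by move=> E; rewrite -(sdcoef_sdform x) E sdcoef_sdform. Qed.

Lemma cross_sdform x y : cross th c p (sdform c p x) (sdform c p y) = sdform c p (crossv x y).
Proof.
rewrite /cross /sdform -/(sdform c p x) -/(sdform c p y); apply: eq_bigr => i _.
have ipE z j : ip g c p (Sigma th c p j) (sdform c p z) = z j.
  by rewrite -/(sdcoef c p _ j) sdcoef_sdform.
by rewrite !ipE.
Qed.

End AtPoint.
End Frame.

(** * Connections in the frame; the Levi-Civita connection *)

Section FrameConnections.
Context (R : realType) (M : topologicalType) (X : oriented_atlas R M).
Context (g : riemannian_metric X) (th : coframe g).
Implicit Types (c : chart_idx X) (p : M).

(** [w] is the connection form of [D] in the frame [Sigma], an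
    [so(3)]-valued form read as a vector: [D = d + [w, -]]. *)
Definition frame_connection c (D : connection R M)
    (w : 'I_4 -> M -> 'I_3 -> R) : Prop :=
  forall k p (x : M -> 'I_3 -> R) v, dom c p ->
  (forall q, dom c q -> v q = sdform th c q (x q)) ->
  (forall i, pderivable c k (x^~ i) p) ->
  D k v p = sdform th c p (fun i => pder c k (x^~ i) p + crossv (w k p) (x p) i).

Lemma frame_connectionD c D w (a : 'I_4 -> M -> 'M[R]_4) al :
  frame_connection c D w ->
  (forall k p, dom c p -> a k p = sdform th c p (al k p)) ->
  frame_connection c (conn_add th c D a) (fun k p i => w k p i + al k p i).
Proof.
move=> Dw aE k p x v cp vE dx; rewrite /conn_add (Dw _ _ _ _ cp vE dx).
rewrite aE// vE// cross_sdform// -sdformD; congr (sdform th c p _).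
by apply/funext => i; rewrite /crossv; ring.
Qed.

Definition christoffel_mx c k p : 'M[R]_4 :=
  \matrix_(l, n) christoffel g c p k l n.

(** The [so(4)]-valued connection form of the Levi-Civita connection in the
    orthonormal coframe: the covariant derivative of the coframe, expressed in
    the coframe. *)
Definition coframe_conn_mx c k p : 'M[R]_4 :=
  (partial c k (th c) p - th c p *m (christoffel_mx c k p)^T) *m invmx (th c p).

(** Twice the self-dual part of [coframe_conn_mx], by [quat_comm]. *)
Definition lc_coef c (k : 'I_4) (p : M) : 'I_3 -> R := fun i =>
  coframe_conn_mx c k p 0 (lift ord0 i) +
  coframe_conn_mx c k p (lift ord0 (i + 1)) (lift ord0 (i + 2%:R)).

Lemma theta_pderivable c k p : dom c p -> pderivable_mx c k (th c) p.
Proof.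
move=> cp; have sA : smooth_mx setT c (fun=> th c).
  exact: (smooth_field_mx openT (@theta_smooth _ _ _ _ th c)).
exact: (smooth_mx_pderivable k (t := 0) sA I cp).
Qed.

Lemma g_pderivable c k p : dom c p -> pderivable_mx c k (g c) p.
Proof.
move=> cp; have sA : smooth_mx setT c (fun=> g c).
  exact: (smooth_field_mx openT (@gmx_smooth _ _ _ g c)).
exact: (smooth_mx_pderivable k (t := 0) sA I cp).
Qed.

(** The two Christoffel terms add up to the derivative of [g] because the
    antisymmetric parts of the Koszul formula cancel. *)
Lemma metric_compat c k p : dom c p ->
  partial c k (g c) p =
    christoffel_mx c k p *m g c p + g c p *m (christoffel_mx c k p)^T.
Proof.
move=> cp.
have [d dE] : exists d : 'I_4 -> 'M[R]_4, forall k, partial c k (g c) p = d k.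
  by exists (fun k => partial c k (g c) p).
have gT : (g c p)^T = g c p by exact: gmx_sym.
have dT k' : (d k')^T = d k'.
  rewrite -dE -partial_trmx; last exact: g_pderivable.
  apply: eq_partial => // q cq; exact: gmx_sym.
have ds k' a b : d k' b a = d k' a b by rewrite -[in LHS]dT mxE.
have ug : g c p \in unitmx.
  rewrite (theta_orthonormal th cp) unitmx_mul unitmx_tr andbb.
  exact: theta_unit.
have CE l m : (christoffel_mx c k p *m g c p) l m =
    2^-1 * (d k l m + d l k m - d m k l).
  pose u : 'rV[R]_4 := \row_a (d k l a + d l k a - d a k l).
  have -> : 2^-1 * (d k l m + d l k m - d m k l) =
      2^-1 * (u *m invmx (g c p) *m g c p) 0 m.
    by rewrite -mulmxA mulVmx// mulmx1 mxE.
  rewrite [in LHS]mxE [in RHS]mxE mulr_sumr; apply: eq_bigr => n _.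
  rewrite mulrA; congr (_ * _); rewrite mxE /christoffel !dE; congr (_ * _).
  rewrite [in RHS]mxE; apply: eq_bigr => a _; rewrite [u 0 a]mxE mulrC.
  have <- : invmx (g c p) n a = invmx (g c p) a n.
    by rewrite -[in RHS]gT -trmx_inv mxE.
  by rewrite !dE.
rewrite dE; apply/matrixP => l m; rewrite [RHS]mxE CE.
have -> : (g c p *m (christoffel_mx c k p)^T) l m =
    (christoffel_mx c k p *m g c p) m l.
  by rewrite -[in LHS]gT -trmx_mul mxE.
rewrite CE (ds k l m).
move: (d k l m) (d l k m) (d m k l) => x y z; by field.
Qed.

Lemma coframe_conn_mx_antisym c k p : dom c p ->
  (coframe_conn_mx c k p)^T = - coframe_conn_mx c k p.
Proof.
move=> cp; set T := th c p; set C := christoffel_mx c k p.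
have uT : T \in unitmx by exact: theta_unit.
have uTt : T^T \in unitmx by rewrite unitmx_tr.
pose dT := partial c k (th c) p.
have E : partial c k (g c) p = dT^T *m T + T^T *m dT.
  rewrite (eq_partial k (f' := fun q => (th c q)^T *m th c q))//; last first.
    by move=> q cq; exact: theta_orthonormal.
  rewrite partial_mulmx//.
  - by rewrite partial_trmx//; exact: theta_pderivable.
  - by apply: pderivable_trmx; exact: theta_pderivable.
  - exact: theta_pderivable.
apply/eqP; rewrite -addr_eq0; apply/eqP.
(* metric compatibility, pulled back along the coframe *)
have Z : T^T *m (coframe_conn_mx c k p)^T *m T +
    T^T *m coframe_conn_mx c k p *m T = 0.
  rewrite /coframe_conn_mx -/T -/C -/dT trmx_mul trmx_inv linearB /=.
  rewrite !mulmxA mulmxV// mul1mx -!mulmxA mulVmx// mulmx1.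
  rewrite trmx_mul trmxK mulmxBl mulmxBr.
  have := metric_compat k cp; rewrite E (theta_orthonormal th cp) -/T -/C.
  rewrite -!mulmxA => /eqP; rewrite -subr_eq0 => /eqP <-.
  by rewrite opprD !addrA; congr (_ - _); rewrite addrAC.
rewrite -mulmxDl -mulmxDr in Z.
have := congr1 (fun A => invmx T^T *m A *m invmx T) Z.
rewrite mulmx0 mul0mx -!mulmxA mulmxV// mulmx1 mulmxA mulVmx// mul1mx.
by [].
Qed.

Lemma GammaLCE c k v p : GammaLC g c k v p =
  partial c k v p - christoffel_mx c k p *m v p
    - v p *m (christoffel_mx c k p)^T.
Proof.
apply/matrixP => l m; rewrite !mxE; congr (_ - _ - _).
  by apply: eq_bigr => n _; rewrite mxE.
by apply: eq_bigr => n _; rewrite !mxE mulrC.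
Qed.

Lemma pderivable_mx_Sigma c k i p : dom c p ->
  pderivable_mx c k (fun q => Sigma th c q i) p.
Proof.
move=> cp; have dT := theta_pderivable k cp.
rewrite (_ : (fun q => _) = fun q => - (Num.sqrt 2)^-1 *:
  ((th c q)^T *m quat (fun j => (j == i)%:R) *m th c q)).
  apply: pderivable_mxZ; first exact: pderivable_cst.
  apply: pderivable_mulmx => //; apply: pderivable_mulmx => //.
    exact: pderivable_trmx.
  exact: pderivable_mx_cst.
by apply/funext => q; rewrite Sigma_sdform sdformE.
Qed.

(** [Sigma_i] has constant coefficients in the coframe, so its covariant
    derivative is a commutator with the connection form of the coframe. *)
Lemma GammaLC_Sigma c k i p : dom c p ->
  GammaLC g c k (fun q => Sigma th c q i) p =
  sdform th c p (crossv (lc_coef c k p) (fun j => (j == i)%:R)).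
Proof.
move=> cp; have dT := theta_pderivable k cp; rewrite GammaLCE.
set K := quat (fun j => (j == i)%:R) : 'M[R]_4.
set T := th c p; set C := christoffel_mx c k p.
pose D := partial c k (th c) p.
have -> : partial c k (fun q => Sigma th c q i) p =
    - (Num.sqrt 2)^-1 *: (D^T *m K *m T + T^T *m K *m D).
  have -> : (fun q => Sigma th c q i) = fun q => - (Num.sqrt 2)^-1 *:
      ((th c q)^T *m K *m th c q).
    by apply/funext => q; rewrite Sigma_sdform sdformE.
  have dTt := pderivable_trmx dT; have dK := pderivable_mx_cst c k K p.
  have dTK := pderivable_mulmx cp dTt dK.
  rewrite (partial_mxZ cp (pderivable_cst c k (- (Num.sqrt 2)^-1) p)
    (pderivable_mulmx cp dTK dT)) pder_cst scale0r addr0 partial_mulmx// partial_mulmx//.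
  by rewrite partial_cst mulmx0 addr0 partial_trmx.
rewrite Sigma_sdform !sdformE -/K -/T -scalemxAr -scalemxAl -!scalerBr.
congr (_ *: _); rewrite -quat_comm; last exact: coframe_conn_mx_antisym.
have uT : T \in unitmx by exact: theta_unit.
have WT : coframe_conn_mx c k p *m T = D - T *m C^T.
  by rewrite /coframe_conn_mx -/T -mulmxA mulVmx// mulmx1.
have TW : T^T *m coframe_conn_mx c k p = - (D^T - C *m T^T).
  rewrite -[RHS]opprK opprK -[in RHS](trmxK (D^T - _)).
  have -> : (D^T - C *m T^T)^T = D - T *m C^T.
    by rewrite linearB /= trmx_mul !trmxK.
  by rewrite -WT trmx_mul coframe_conn_mx_antisym// mulmxN opprK.
set W := coframe_conn_mx c k p in WT TW *.
transitivity (T^T *m K *m (W *m T) - (T^T *m W) *m K *m T); last first.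
  by rewrite mulmxBr mulmxBl !mulmxA.
rewrite WT TW !mulNmx opprK !mulmxBl mulmxBr !mulmxA.
by rewrite [RHS]addrC !addrA; congr (_ - _); rewrite addrAC.
Qed.

Lemma frame_connection_LC c : frame_connection c (GammaLC g c) (lc_coef c).
Proof.
move=> k p x v cp vE dx.
rewrite GammaLCE vE//.
rewrite (eq_partial k (f' := fun q => \sum_i x q i *: Sigma th c q i))//.
have dS i : pderivable_mx c k (fun q => Sigma th c q i) p by exact: pderivable_mx_Sigma.
rewrite partial_mx_sum; last by move=> i; exact: pderivable_mxZ.
rewrite sdformD mulmx_sumr mulmx_suml -!sumrB.
have crossE : sdform th c p (crossv (lc_coef c k p) (x p)) =
    \sum_i x p i *: sdform th c p (crossv (lc_coef c k p) (fun j => (j == i)%:R)).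
  rewrite sum3E -!sdformZ -!sdformD; congr (sdform th c p _); apply/funext.
  by elim/ord3_ind; rewrite /crossv ?add0r ?ord3_add ?add0r /=; ring.
rewrite crossE /sdform -big_split /=; apply: eq_bigr => i _.
rewrite -/(sdform th c p _) -GammaLC_Sigma// GammaLCE partial_mxZ//.
rewrite -scalemxAl -scalemxAr !scalerBr.
by rewrite [x p i *: partial _ _ _ _ + _]addrC -!addrA.
Qed.

End FrameConnections.

(** * Curvature and exterior derivatives in the frame *)

Lemma ord3_cyc (i : 'I_3) : ((i + 1 + 1 = i + 2%:R) * (i + 1 + 2%:R = i) *
  (i + 2%:R + 1 = i) * (i + 2%:R + 2%:R = i + 1)).
Proof. by elim/ord3_ind: i; rewrite ?add0r ?ord3_add ?add0r ?ord3_add. Qed.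

Lemma crossv_injl (R : realType) (y z : 'I_3 -> R) :
  (forall i, crossv y (fun j => (j == i)%:R) = crossv z (fun j => (j == i)%:R)) ->
  y = z.
Proof.
move=> E; apply/funext => i; have := congr1 (fun f => f (i + 2%:R)) (E (i + 1)).
have ne : (i == i + 1) = false by elim/ord3_ind: i.
by rewrite /crossv !ord3_cyc eqxx ne !mulr0 !mulr1 !subr0.
Qed.

Section FrameCalculus.
Context (R : realType) (M : topologicalType) (X : oriented_atlas R M).
Context (g : riemannian_metric X) (th : coframe g).
Implicit Types (c : chart_idx X) (p : M).

Section Smoothness.
Context (J : set R) (openJ : open J) (c : chart_idx X).

Lemma smooth_theta : smooth_mx J c (fun=> th c).
Proof. by apply: smooth_field_mx => //; exact: theta_smooth. Qed.

Lemma smooth_metric : smooth_mx J c (fun=> g c).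
Proof. by apply: smooth_field_mx => //; exact: gmx_smooth. Qed.

Lemma smooth_inv_theta : smooth_mx J c (fun _ p => invmx (th c p)).
Proof.
apply: smooth_invmx => //; last exact: smooth_theta.
by move=> t p _ cp; exact: theta_unit.
Qed.

Lemma smooth_inv_metric : smooth_mx J c (fun _ p => invmx (g c p)).
Proof.
apply: smooth_invmx => //; last exact: smooth_metric.
move=> t p _ cp; rewrite (theta_orthonormal th cp) unitmx_mul unitmx_tr andbb.
exact: theta_unit.
Qed.

Lemma smooth_christoffel k : smooth_mx J c (fun _ p => christoffel_mx g c k p).
Proof.
move=> l n; rewrite (_ : (fun _ _ => _) = fun _ p => christoffel g c p k l n).
  rewrite /christoffel; apply: smooth_scalarM => //.
    exact: smooth_scalar_cst.
  apply: smooth_scalar_sum => // a; apply: smooth_scalarM => //.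
    exact: smooth_inv_metric.
  have dg k' : smooth_mx J c (fun _ p => partial c k' (g c) p).
    by apply: smooth_mx_partial => //; exact: smooth_metric.
  by apply: smooth_scalarB => //; [apply: smooth_scalarD => //|]; exact: dg.
by apply/funext => t; apply/funext => p; rewrite mxE.
Qed.

Lemma smooth_lc_coef k i : smooth_scalar J c (fun _ p => lc_coef th c k p i).
Proof.
have sW : smooth_mx J c (fun _ p => coframe_conn_mx th c k p).
  apply: smooth_mxM => //; last exact: smooth_inv_theta.
  apply: smooth_mxB => //; first exact: (smooth_mx_partial openJ k smooth_theta).
  apply: smooth_mxM => //; first exact: smooth_theta.
  by apply: smooth_mxT; exact: smooth_christoffel.
by apply: smooth_scalarD => //; exact: sW.
Qed.

Lemma smooth_Sigma i : smooth_mx J c (fun _ p => Sigma th c p i).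
Proof.
rewrite (_ : (fun _ _ => _) = fun _ q => (- (Num.sqrt 2)^-1 *:
    (th c q)^T) *m quat (fun j => (j == i)%:R) *m th c q).
  apply: smooth_mxM => //; last exact: smooth_theta.
  apply: smooth_mxM => //; last by move=> a b; exact: smooth_scalar_cst.
  move=> a b; rewrite (_ : (fun _ _ => _) =
      fun _ q => - (Num.sqrt 2)^-1 * th c q b a).
    apply: smooth_scalarM => //; first exact: smooth_scalar_cst.
    exact: smooth_theta.
  by apply/funext => t; apply/funext => p; rewrite !mxE.
by apply/funext => t; apply/funext => p; rewrite Sigma_sdform sdformE -!scalemxAl.
Qed.

Lemma smooth_sdcoef (v : R -> M -> 'M[R]_4) i :
  smooth_mx J c v -> smooth_scalar J c (fun t p => sdcoef th c p (v t p) i).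
Proof.
move=> sv; rewrite /sdcoef /ip; apply: smooth_scalarM => //.
  exact: smooth_scalar_cst.
have sP : smooth_mx J c (fun t p => invmx (g c p) *m Sigma th c p i *m
    invmx (g c p) *m (v t p)^T).
  apply: smooth_mxM => //; last exact: smooth_mxT.
  apply: smooth_mxM => //; last exact: smooth_inv_metric.
  by apply: smooth_mxM => //; [exact: smooth_inv_metric|exact: smooth_Sigma].
by rewrite /mxtrace; apply: smooth_scalar_sum => // j; exact: sP.
Qed.

End Smoothness.

Lemma smooth_section_Sigma c i : smooth_section g c (fun p => Sigma th c p i).
Proof.
split=> [p cp|]; first by rewrite Sigma_sdform; exact: LambdaP_sdform.
apply/smooth_field_mxP => a b.
exact: (smooth_scalar_slice (J := setT) (t := 0) I (smooth_Sigma openT c i a b)).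
Qed.

Lemma smooth_section_coef c v : smooth_section g c v ->
  exists x : M -> 'I_3 -> R, (forall q, dom c q -> v q = sdform th c q (x q)) /\
    (forall i, smooth_scalar setT c (fun _ q => x q i)).
Proof.
move=> [Lv sv]; exists (fun q => sdcoef th c q (v q)).
split=> [q cq|i]; first by apply: LambdaP_sdformE => //; exact: Lv.
apply: (smooth_sdcoef openT (v := fun=> v)); exact: (smooth_field_mx openT sv).
Qed.

(** [dw + [w /\ w] / 2], the curvature of the connection form [w]. *)
Definition curv_coef c (w : 'I_4 -> M -> 'I_3 -> R) k l p : 'I_3 -> R := fun i =>
  pder c k (fun q => w l q i) p - pder c l (fun q => w k q i) p
  + crossv (w k p) (w l p) i.

Lemma pder_crossv c k (x y : M -> 'I_3 -> R) p i : dom c p ->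
  (forall i, pderivable c k (x^~ i) p) -> (forall i, pderivable c k (y^~ i) p) ->
  pderivable c k (fun q => crossv (x q) (y q) i) p /\
  pder c k (fun q => crossv (x q) (y q) i) p =
    crossv (fun i => pder c k (x^~ i) p) (y p) i
    + crossv (x p) (fun i => pder c k (y^~ i) p) i.
Proof.
move=> cp dx dy; rewrite /crossv.
have dM j l := pderivableM (dx j) (dy l).
have dN := pderivableN (dM (i + 2%:R) (i + 1)).
split; first exact: (pderivableD (dM _ _) dN).
rewrite (pderD (dM _ _) dN) (pderN (dM _ _)) !(pderM cp (dx _) (dy _)).
ring.
Qed.

(** In [d_D d_D v] the second derivatives of [v] cancel by symmetry, the first
    derivatives cancel in pairs, and the Jacobi identity leaves the bracket of
    [curv_coef] with [v].  Testing on the sections [Sigma_i] shows that no other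
    self-dual form has this property. *)
Lemma frame_curvature c D (w : 'I_4 -> M -> 'I_3 -> R) k l p :
  frame_connection th c D w ->
  (forall k i, smooth_scalar setT c (fun _ q => w k q i)) -> dom c p ->
  curvature th c D k l p = sdform th c p (curv_coef c w k l p).
Proof.
move=> Dw sw cp.
have dw n j i q : dom c q -> pderivable c n (fun q => w j q i) q.
  by move=> cq; exact: (smooth_scalar_pderivable n (sw j i) (t := 0) I cq).
have FE v : smooth_section g c v ->
    dcov1 D (dcov0 D v) k l p = cross th c p (sdform th c p (curv_coef c w k l p)) (v p).
  move=> /smooth_section_coef[x [vE sx]].
  have dx n i q : dom c q -> pderivable c n (x^~ i) q.
    by move=> cq; exact: (smooth_scalar_pderivable n (sx i) (t := 0) I cq).
  pose y n q i := pder c n (x^~ i) q + crossv (w n q) (x q) i.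
  have DvE n q : dom c q -> D n v q = sdform th c q (y n q).
    by move=> cq; rewrite (Dw _ _ _ _ cq vE) // => i; exact: dx.
  have dpx n m i : pderivable c n (fun q => pder c m (x^~ i) q) p.
    exact: (smooth_scalar_pderivable n (smooth_scalar_pder openT m (sx i))
      (t := 0) I cp).
  have dwx n m i := pder_crossv i cp (fun j => dw n m j p cp) (fun j => dx n j p cp).
  have dy n m i : pderivable c n ((y m)^~ i) p.
    exact: (pderivableD (dpx n m i) (dwx n m i).1).
  have DDvE n m : D n (D m v) p =
      sdform th c p (fun i => pder c n ((y m)^~ i) p + crossv (w n p) (y m p) i).
    exact: (Dw _ _ _ _ cp (DvE m) (dy n m)).
  rewrite /dcov1 /dcov0 !DDvE -sdformB vE// cross_sdform//; congr (sdform th c p _).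
  apply/funext => i; rewrite /y.
  rewrite !(pderD (dpx _ _ i) (dwx _ _ i).1) !(dwx _ _ i).2.
  have -> := pder_sym openT k l (sx i) (t := 0) I cp.
  rewrite /crossv /curv_coef /crossv !ord3_cyc.
  ring.
apply: xget_unique; first by split=> //; exact: LambdaP_sdform.
move=> f [/(LambdaP_sdformE th cp) -> fP]; congr (sdform th c p _).
apply: crossv_injl => i; have := fP _ (smooth_section_Sigma c i).
rewrite FE; last exact: smooth_section_Sigma.
by rewrite Sigma_sdform !cross_sdform// => /(sdform_inj cp).
Qed.

Definition d1_coef c (w al : 'I_4 -> M -> 'I_3 -> R) k l p : 'I_3 -> R := fun i =>
  pder c k (fun q => al l q i) p + crossv (w k p) (al l p) i
  - (pder c l (fun q => al k q i) p + crossv (w l p) (al k p) i).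

Lemma frame_dcov1 c D w a (al : 'I_4 -> M -> 'I_3 -> R) k l p :
  frame_connection th c D w -> dom c p ->
  (forall k q, dom c q -> a k q = sdform th c q (al k q)) ->
  (forall k l i, pderivable c k (fun q => al l q i) p) ->
  dcov1 D a k l p = sdform th c p (d1_coef c w al k l p).
Proof.
move=> Dw cp aE dal; rewrite /dcov1.
by rewrite !(Dw _ _ _ _ cp (aE _) (dal _ _)) -sdformB.
Qed.

Definition d2_coef c (w : 'I_4 -> M -> 'I_3 -> R)
    (be : 'I_4 -> 'I_4 -> M -> 'I_3 -> R) j l m p : 'I_3 -> R := fun i =>
  (pder c j (fun q => be l m q i) p + crossv (w j p) (be l m p) i)
  + (pder c l (fun q => be m j q i) p + crossv (w l p) (be m j p) i)
  + (pder c m (fun q => be j l q i) p + crossv (w m p) (be j l p) i).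

Lemma frame_dcov2 c D w B be j l m p :
  frame_connection th c D w -> dom c p ->
  (forall k l q, dom c q -> B k l q = sdform th c q (be k l q)) ->
  (forall j k l i, pderivable c j (fun q => be k l q i) p) ->
  dcov2 D B j l m p = sdform th c p (d2_coef c w be j l m p).
Proof.
move=> Dw cp BE dbe; rewrite /dcov2.
by rewrite !(Dw _ _ _ _ cp (BE _ _) (dbe _ _ _)) -!sdformD.
Qed.

Lemma Bform_sdform (E : endo_field X) c k l p :
  Bform th E c k l p = sdform th c p (fun i => E c p (Sigma th c p i) k l).
Proof. by []. Qed.

Lemma ad_sdform (E : endo_field X) c p (al : 'I_4 -> 'I_3 -> R) j l m : dom c p ->
  ad th E c p (fun k => sdform th c p (al k)) j l m = sdform th c p (fun i =>
    let a i : 'rV[R]_4 := \row_k al k i in let S i := E c p (Sigma th c p i) in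
    wedge12 (a (i + 1)) (S (i + 2%:R)) j l m
    - wedge12 (a (i + 2%:R)) (S (i + 1)) j l m).
Proof.
move=> cp; rewrite /ad !Bform_sdform !cross_sdform// -!sdformD; congr (sdform th c p _).
by apply/funext => i; rewrite /wedge12 /crossv /= !mxE; ring.
Qed.

End FrameCalculus.

(** * Pointwise inversion of endomorphisms and of ad *)

Section PointwiseAlgebra.
Context (R : realType) (M : topologicalType) (X : oriented_atlas R M).
Context (g : riemannian_metric X) (th : coframe g).
Implicit Types (E : endo_field X).

Definition endo_mx E (c : chart_idx X) (p : M) : 'M[R]_3 :=
  \matrix_(j, i) sdcoef th c p (E c p (Sigma th c p j)) i.

Section AtPoint.
Context (c : chart_idx X) (p : M) (cp : dom c p).

Lemma LambdaP_Sigma i : LambdaP g c p (Sigma th c p i).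
Proof. by rewrite Sigma_sdform; exact: LambdaP_sdform. Qed.

Lemma endo_Sigma E i : is_endo g E ->
  E c p (Sigma th c p i) = sdform th c p (endo_mx E c p i).
Proof.
move=> [EL _]; rewrite {1}(LambdaP_sdformE th cp (EL _ _ _ cp (LambdaP_Sigma i))).
by congr (sdform th c p _); apply/funext => j; rewrite mxE.
Qed.

Lemma endo_sdform E x : is_endo g E ->
  E c p (sdform th c p x) = sdform th c p (fun i => ((\row_j x j) *m endo_mx E c p) 0 i).
Proof.
move=> Ee; have [EL [Elin _]] := Ee.
(* linearity over self-dual forms gives E 0 = 0, needed to split off scalars *)
have L0 : LambdaP g c p 0.
  by rewrite -(scale0r (sdform th c p x)) -sdformZ; exact: LambdaP_sdform.
have E0 : E c p 0 = 0.
  have := Elin c p 1 0 0 cp L0 L0; rewrite !scale1r addr0 => /eqP.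
  by rewrite -subr_eq0 opprD addrA subrr sub0r oppr_eq0 => /eqP.
have LS := LambdaP_Sigma.
have Ec a i : E c p (a *: Sigma th c p i) = a *: E c p (Sigma th c p i).
  by have := Elin c p a _ 0 cp (LS i) L0; rewrite !addr0 E0 addr0.
have LZ a i : LambdaP g c p (a *: Sigma th c p i).
  by rewrite Sigma_sdform -sdformZ; exact: LambdaP_sdform.
have sdform3 y : sdform th c p y = y 0 *: Sigma th c p 0 +
    (y 1 *: Sigma th c p 1 + y 2%:R *: Sigma th c p 2%:R).
  by rewrite /sdform sum3E addrA.
have LD : LambdaP g c p (x 1 *: Sigma th c p 1 + x 2%:R *: Sigma th c p 2%:R).
  rewrite !Sigma_sdform -!sdformZ -sdformD; exact: LambdaP_sdform.
rewrite {1}sdform3 Elin // Elin // Ec !endo_Sigma // -!sdformZ -!sdformD.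
congr (sdform th c p _); apply/funext => i.
by rewrite [RHS]mxE sum3E !mxE addrA.
Qed.

(** A vector in the kernel would violate the positivity of [E]. *)
Lemma endo_mx_unit E : Omega0_Sym2_pos g E -> endo_mx E c p \in unitmx.
Proof.
move=> [[Ee _] Epos]; rewrite unitmxE unitfE; apply/negP => /eqP/eqP/det0P.
move=> [v v0 vE]; have := Epos c p (sdform th c p (v 0)) cp (LambdaP_sdform th cp _).
have -> : E c p (sdform th c p (v 0)) = sdform th c p (fun=> 0).
  rewrite endo_sdform//; congr (sdform th c p _); apply/funext => i.
  rewrite (_ : \row_j v 0 j = v) ?vE ?mxE//.
  by apply/rowP => j; rewrite mxE.
rewrite ip_sdform// /dotv big1; last by move=> i _; rewrite mul0r.
rewrite ltxx => H; suff : false by []; apply: H.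
apply: contraNneq v0 => vfr; apply/eqP/rowP => i.
have := congr1 (fun s => sdcoef th c p s i) vfr; rewrite sdcoef_sdform// mxE => ->.
have -> : (0 : 'M[R]_4) = sdform th c p (fun=> 0).
  by rewrite -(scale0r (sdform th c p (v 0))) -sdformZ; congr (sdform _ _ _ _);
     apply/funext => j; rewrite mul0r.
by rewrite sdcoef_sdform.
Qed.

Lemma endo_inv_sdform E y : Omega0_Sym2_pos g E -> endo_inv g E c p (sdform th c p y) =
  sdform th c p (fun i => ((\row_j y j) *m invmx (endo_mx E c p)) 0 i).
Proof.
move=> Epos; have [[Ee _] _] := Epos; have uE := endo_mx_unit Epos.
have rowE (r : 'rV[R]_3) : \row_j r 0 j = r by apply/rowP => j; rewrite mxE.
apply: xget_unique.
  split; first exact: LambdaP_sdform.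
  rewrite endo_sdform// rowE -mulmxA mulVmx// mulmx1.
  by congr (sdform th c p _); apply/funext => i; rewrite mxE.
move=> s [/(LambdaP_sdformE th cp) ->]; set x := sdcoef th c p s.
rewrite endo_sdform// => /(sdform_inj cp) xE; congr (sdform th c p _).
apply/funext => i; have -> : \row_j y j = \row_j x j *m endo_mx E c p.
  by apply/rowP => j; rewrite mxE -xE.
by rewrite -mulmxA mulmxV// mulmx1 mxE.
Qed.

Lemma triple_det (A : 'M[R]_3) : triple (fun i j => A i j) = \det A.
Proof.
rewrite det3E /triple /dotv sum3E /crossv ?add0r ?ord3_add ?add0r; ring.
Qed.

Let T := th c p.

Lemma star_sdform x : star (sdform th c p x) =
  - (Num.sqrt 2)^-1 * \det T *: (invmx T *m quat x *m (invmx T)^T).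
Proof.
have uT : T \in unitmx by exact: theta_unit.
have uTt : T^T \in unitmx by rewrite unitmx_tr.
have := star_frame T^T (- (Num.sqrt 2)^-1 *: quat x).
rewrite trmxK det_tr -scalemxAr -scalemxAl -sdformE -quatZ star_quat quatZ.
move=> /(congr1 (fun A => invmx T *m A *m invmx T^T)).
rewrite -!mulmxA mulmxV// mulmx1 mulmxA mulVmx// mul1mx => ->.
by rewrite scalerA mulrC -scalemxAl -scalemxAr trmx_inv.
Qed.

(** The [i]-th coefficient of the 3-form [[a, B]], for [a] with
    coefficients [al] and [B] with first factors [S]. *)
Definition ad_coef (S : 'I_3 -> 'M[R]_4) (al : 'I_4 -> 'I_3 -> R) (i : 'I_3)
    (j l m : 'I_4) : R :=
  let a i : 'rV[R]_4 := \row_k al k i in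
  wedge12 (a (i + 1)) (S (i + 2%:R)) j l m
  - wedge12 (a (i + 2%:R)) (S (i + 1)) j l m.

(** The inverse of [quat_cross_solve], transported from the coframe to the
    coordinates.  Being explicit, it shows at once that [ad_h^-1] depends
    smoothly on [h] and on the point. *)
Definition ad_solution (H : 'I_3 -> 'I_3 -> R)
    (b : 'I_3 -> 'I_4 -> 'I_4 -> 'I_4 -> R) (k : 'I_4) (i : 'I_3) : R :=
  (2 * triple H * ((Num.sqrt 2)^-1 * \det T))^-1 *
  (\sum_j (dual3 (b j) *m T^T) *m (quat (H i) *m quat (H j)) *m T) 0 k.

Section Solve.
Context (H : 'I_3 -> 'I_3 -> R) (H0 : triple H != 0).
Let S i := sdform th c p (H i).

Lemma ad_coef_alternating al i : alternating3 (ad_coef S al i).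
Proof. by apply: alternating3B; apply: wedge12_alternating; exact: trmx_sdform. Qed.

Lemma dual3_ad_coef al i (a := fun i => (\row_k al k i) *m invmx T) :
  dual3 (ad_coef S al i) = - (Num.sqrt 2)^-1 * \det T *:
    ((a (i + 1) *m quat (H (i + 2%:R)) - a (i + 2%:R) *m quat (H (i + 1)))
       *m (invmx T)^T).
Proof.
have dualB b b' : dual3 (fun j l m => b j l m - b' j l m) = dual3 b - dual3 b'.
  by apply/rowP; elim/ord4_ind; rewrite !mxE /=; ring.
rewrite dualB !dual3_wedge12; try exact: trmx_sdform.
rewrite /S !star_sdform -!scalemxAr -scalerBr mulmxBl !mulmxA.
by rewrite /a.
Qed.

(** Dualizing the 3-forms turns the equation into the quaternionic one in
    the coframe. *)
Lemma ad_solutionP b i j l m : (forall i, alternating3 (b i)) ->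
  ad_coef S (ad_solution H b) i j l m = b i j l m.
Proof.
move=> ab; apply: dual3_inj => //; first exact: ad_coef_alternating.
rewrite dual3_ad_coef.
have uT : T \in unitmx by exact: theta_unit.
have dT : \det T != 0 by rewrite -unitfE -unitmxE.
have uTt : T^T \in unitmx by rewrite unitmx_tr.
have s0 : Num.sqrt 2 != 0 :> R by rewrite gt_eqF// sqrtr_gt0.
set kap := (2 * triple H * ((Num.sqrt 2)^-1 * \det T))^-1.
pose v j := dual3 (b j) *m T^T.
have aE i' : (\row_k ad_solution H b k i') *m invmx T =
    kap *: \sum_j v j *m (quat (H i') *m quat (H j)).
  have -> : \row_k ad_solution H b k i' =
      kap *: (\sum_j v j *m (quat (H i') *m quat (H j))) *m T.
    by apply/rowP => k; rewrite mxE -scalemxAl mxE mulmx_suml.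
  by rewrite -mulmxA mulmxV// mulmx1.
rewrite !aE -!scalemxAl -scalerBr quat_cross_solve scalerA -!scalemxAl scalerA.
rewrite /v -mulmxA trmx_inv mulmxV// mulmx1 -[RHS]scale1r; congr (_ *: _).
by rewrite /kap; field; rewrite ?dT ?s0 ?H0.
Qed.

Lemma ad_coef_inj al al' :
  (forall i j l m, ad_coef S al i j l m = ad_coef S al' i j l m) -> al = al'.
Proof.
move=> E.
have uT : T \in unitmx by exact: theta_unit.
have dT : \det T != 0 by rewrite -unitfE -unitmxE.
have uTt : T^T \in unitmx by rewrite unitmx_tr.
have s0 : (Num.sqrt 2)^-1 != 0 :> R by rewrite invr_eq0 gt_eqF// sqrtr_gt0.
pose u (al : 'I_4 -> 'I_3 -> R) i := (\row_k al k i) *m invmx T.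
pose v (al : 'I_4 -> 'I_3 -> R) i :=
  u al (i + 1) *m quat (H (i + 2%:R)) - u al (i + 2%:R) *m quat (H (i + 1)).
have vE i : v al i = v al' i.
  have : dual3 (ad_coef S al i) = dual3 (ad_coef S al' i).
    by congr dual3; apply/funext => j; apply/funext => l; apply/funext => m.
  rewrite !dual3_ad_coef.
  move=> /(congr1 (fun A => (- (Num.sqrt 2)^-1 * \det T)^-1 *: A *m T^T)).
  rewrite !scalerA mulVf ?scale1r; last by rewrite mulf_neq0// oppr_eq0.
  by rewrite trmx_inv -!(mulmxA (_ - _)) mulVmx// !mulmx1.
have uE i : u al i = u al' i.
  have H2 : - 2 * triple H != 0 by rewrite mulf_neq0// oppr_eq0.
  have := quat_cross_inj H (u al) i; have := quat_cross_inj H (u al') i.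
  move=> E2 E1; apply: (scalerI H2); rewrite -E1 -E2.
  by apply: eq_bigr => j _; rewrite -!/(v _ _) vE.
apply/funext => k; apply/funext => i.
have := congr1 (fun A => (A *m T) 0 k) (uE i).
by rewrite /u -!mulmxA mulVmx// !mulmx1 !mxE.
Qed.

End Solve.

Lemma ad_inv_sdform E (H := fun i j => endo_mx E c p i j) b (al : 'I_4 -> 'I_3 -> R) k :
  triple H != 0 ->
  (forall i, E c p (Sigma th c p i) = sdform th c p (H i)) ->
  (forall j l m, ad th E c p (fun k => sdform th c p (al k)) j l m = b j l m p) ->
  ad_inv th E c b k p = sdform th c p (al k).
Proof.
move=> H0 SE adE; rewrite /ad_inv.
have -> : xget (fun=> 0 : 'M[R]_4) [set a : 'I_4 -> 'M[R]_4 |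
      (forall j, LambdaP g c p (a j)) /\
      (forall j l m, ad th E c p a j l m = b j l m p)] =
    fun k => sdform th c p (al k); last by [].
apply: xget_unique.
  by split=> // j; exact: LambdaP_sdform.
move=> a [aL aE]; pose al' j := sdcoef th c p (a j).
have aE' : a = fun j => sdform th c p (al' j).
  by apply/funext => j; exact: LambdaP_sdformE.
suff -> : al = al' by [].
apply: (ad_coef_inj H0) => i j l m.
have := adE j l m; rewrite -aE aE' !ad_sdform// => /(sdform_inj cp).
by move=> /(congr1 (fun f => f i)); rewrite /ad_coef !SE.
Qed.

End AtPoint.
End PointwiseAlgebra.

(** * The connections A(h(t)) *)

Section TimeDerivatives.
Context (R : realType) (M : topologicalType) (X : oriented_atlas R M).
Context (J : set R) (openJ : open J) (c : chart_idx X).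
Implicit Types (F G : R -> M -> R) (t : R) (p : M).

Lemma eq_time_der F G t p : (forall s, J s -> F s p = G s p) -> J t ->
  time_der F t p = time_der G t p.
Proof.
move=> FG Jt; rewrite !time_derE; apply: near_eq_derive.
by apply: filterS (open_nbhs_nbhs (conj openJ Jt)) => s /FG.
Qed.

Section Rules.
Context (F G : R -> M -> R) (t : R) (p : M).
Hypotheses (sF : smooth_scalar J c F) (sG : smooth_scalar J c G).
Hypotheses (Jt : J t) (cp : dom c p).
Let dF := smooth_scalar_is_derive sF Jt cp.
Let dG := smooth_scalar_is_derive sG Jt cp.

Lemma time_derD : time_der (fun s q => F s q + G s q) t p =
  time_der F t p + time_der G t p.
Proof.
rewrite [LHS]time_derE.
have D := is_deriveD dF dG; exact: (@derive_val _ _ _ _ _ _ _ D).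
Qed.

Lemma time_derB : time_der (fun s q => F s q - G s q) t p =
  time_der F t p - time_der G t p.
Proof.
rewrite [LHS]time_derE.
have D := is_deriveB dF dG; exact: (@derive_val _ _ _ _ _ _ _ D).
Qed.

Lemma time_derM : time_der (fun s q => F s q * G s q) t p =
  time_der F t p * G t p + F t p * time_der G t p.
Proof.
rewrite [LHS]time_derE.
have D := is_deriveM dF dG; apply: etrans (@derive_val _ _ _ _ _ _ _ D) _.
by rewrite addrC [X in X + _](mulrC (G t p)).
Qed.

End Rules.

Lemma time_der_cst (f : M -> R) t p : time_der (fun _ q => f q) t p = 0.
Proof. by rewrite time_derE; exact: derive_cst. Qed.

Lemma time_der_sum (I : Type) (s : seq I) (F : I -> R -> M -> R) t p :
  (forall i, smooth_scalar J c (F i)) -> J t -> dom c p ->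
  time_der (fun t q => \sum_(i <- s) F i t q) t p =
  \sum_(i <- s) time_der (F i) t p.
Proof.
move=> sF Jt cp; elim: s => [|i s IH].
  rewrite big_nil; apply: etrans (time_der_cst (fun=> 0) t p).
  by apply: eq_time_der => // u _; rewrite big_nil.
rewrite big_cons -IH -(time_derD (sF i) (smooth_scalar_sum openJ s sF) Jt cp).
by apply: eq_time_der => // u _; rewrite big_cons.
Qed.

End TimeDerivatives.

Lemma is_derive_mx (R : realType) m n (F : R^o -> 'M[R]_(m, n)) (dF : 'M[R]_(m, n)) t :
  (forall i j, is_derive (t : R^o) (1 : R^o) (fun s : R^o => F s i j : R^o) (dF i j)) ->
  is_derive (t : R^o) (1 : R^o) F dF.
Proof.
move=> dFij.
have D : derivable F (t : R^o) (1 : R^o).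
  by apply/derivable_mxP => i j; exact: (@ex_derive _ _ _ _ _ _ _ (dFij i j)).
split=> //; apply/matrixP => i j; rewrite derive_mx// mxE.
exact: (@derive_val _ _ _ _ _ _ _ (dFij i j)).
Qed.

Section Variation.
Context (R : realType) (M : topologicalType) (X : oriented_atlas R M).
Context (g : riemannian_metric X) (th : coframe g).
Context (J : set R) (openJ : open J) (J0 : J 0) (ht : R -> endo_field X).
Context (ht_pos : forall t, J t -> Omega0_Sym2_pos g (ht t)).
Context (ht_smooth : smooth_variation g J ht) (c : chart_idx X).
Implicit Types (t : R) (p : M).

Let S t i p := ht t c p (Sigma th c p i).
Let Hm t p := endo_mx th (ht t) c p.
Let Be t (l m : 'I_4) p : 'I_3 -> R := fun i => S t i p l m.

Let ht_endo t : J t -> is_endo g (ht t).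
Proof. by move=> /ht_pos[[]]. Qed.

Lemma smooth_ht_Sigma i : smooth_mx J c (fun t p => S t i p).
Proof.
have := ht_smooth (smooth_section_Sigma th c i).
by move/(smooth_family_mxP openJ) => sS a b; exact: sS.
Qed.

Lemma smooth_endo_mx : smooth_mx J c Hm.
Proof.
move=> j i; rewrite (_ : (fun _ _ => _) = fun t p => sdcoef th c p (S t j p) i).
  exact: (smooth_sdcoef th openJ i (smooth_ht_Sigma j)).
by apply/funext => t; apply/funext => p; rewrite /Hm mxE.
Qed.

Lemma smooth_inv_endo_mx : smooth_mx J c (fun t p => invmx (Hm t p)).
Proof.
apply: smooth_invmx => //; last exact: smooth_endo_mx.
by move=> t p Jt cp; exact/endo_mx_unit/ht_pos.
Qed.

Lemma ht_Sigma_sdform t i p : J t -> dom c p -> S t i p = sdform th c p (Hm t p i).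
Proof. by move=> Jt cp; exact/endo_Sigma/ht_endo. Qed.

Lemma triple_endo_mx_neq0 t p : J t -> dom c p -> triple (fun i j => Hm t p i j) != 0.
Proof.
move=> Jt cp; rewrite triple_det -unitfE -unitmxE.
exact/endo_mx_unit/ht_pos.
Qed.

(** The [i]-th coefficient of [d_Gamma B_{h(t)}]. *)
Definition dGammaB t i j l m p : R := d2_coef c (lc_coef th c) (Be t) j l m p i.

Let smooth_Be l m i : smooth_scalar J c (fun t p => Be t l m p i).
Proof. exact: smooth_ht_Sigma. Qed.

Lemma smooth_crossv (x y : R -> M -> 'I_3 -> R) i :
  (forall i, smooth_scalar J c (fun t p => x t p i)) ->
  (forall i, smooth_scalar J c (fun t p => y t p i)) ->
  smooth_scalar J c (fun t p => crossv (x t p) (y t p) i).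
Proof.
by move=> sx sy; apply: smooth_scalarB => //; apply: smooth_scalarM.
Qed.

Lemma smooth_dGammaB i j l m : smooth_scalar J c (fun t p => dGammaB t i j l m p).
Proof.
have sX j' l' m' : smooth_scalar J c (fun t p =>
    pder c j' (fun q => Be t l' m' q i) p + crossv (lc_coef th c j' p) (Be t l' m' p) i).
  apply: smooth_scalarD => //; first exact: (smooth_scalar_pder openJ j' (smooth_Be l' m' i)).
  apply: (smooth_crossv (x := fun=> lc_coef th c j')) => // i'.
  exact: smooth_lc_coef.
by apply: smooth_scalarD => //; apply: smooth_scalarD.
Qed.

Lemma dGammaB_alternating t i p : J t -> dom c p ->
  alternating3 (fun j l m => dGammaB t i j l m p).
Proof.
move=> Jt cp.
have aBe q l m i' : dom c q -> Be t m l q i' = - Be t l m q i'.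
  move=> cq; have := ht_Sigma_sdform i' Jt cq => E.
  have := trmx_sdform th c q (Hm t q i'); rewrite -E => /matrixP/(_ l m).
  by rewrite !mxE.
pose Y j l m := pder c j (fun q => Be t l m q i) p + crossv (lc_coef th c j p) (Be t l m p) i.
have aY j l m : Y j m l = - Y j l m.
  rewrite /Y (eq_pder j (f' := fun q => - Be t l m q i))//; last first.
    by move=> q cq; exact: aBe.
  rewrite pderN; last exact: (smooth_scalar_pderivable j (smooth_Be l m i) Jt cp).
  by rewrite /crossv !(aBe p l m)//; ring.
have DE j l m : dGammaB t i j l m p = Y j l m + Y l m j + Y m j l by [].
by split=> j l m; rewrite !DE; [rewrite (aY l) (aY j) (aY m)|
  rewrite (aY j) (aY m) (aY l)]; ring.
Qed.

(** The coefficients of [ad_h^-1 (d_Gamma B_h)] for [h = h(t)]. *)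
Definition Acoef t k p i : R :=
  ad_solution th c p (fun i j => Hm t p i j) (fun i j l m => dGammaB t i j l m p) k i.

(** [quat] is linear, so each entry is a combination of coordinates with
    constant coefficients. *)
Lemma smooth_quat (x : R -> M -> 'I_3 -> R) :
  (forall i, smooth_scalar J c (fun t p => x t p i)) ->
  smooth_mx J c (fun t p => quat (x t p)).
Proof.
move=> sx a b; rewrite (_ : (fun _ _ => _) = fun t p =>
    \sum_i x t p i * (quat (fun j => (j == i)%:R : R)) a b).
  apply: smooth_scalar_sum => // i; apply: smooth_scalarM => //.
  exact: smooth_scalar_cst.
apply/funext => t; apply/funext => p; rewrite sum3E; move: a b.
by elim/ord4_ind; elim/ord4_ind; rewrite !mxE /=; ring.
Qed.

Lemma smooth_dual3 (b : R -> M -> 'I_4 -> 'I_4 -> 'I_4 -> R) :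
  (forall j l m, smooth_scalar J c (fun t p => b t p j l m)) ->
  smooth_mx J c (fun t p => dual3 (b t p)).
Proof.
move=> sb a n; rewrite (ord1 a) (_ : (fun _ _ => _) = fun t p =>
    nth 0 [:: - b t p 1 2%:R 3%:R; b t p 0 2%:R 3%:R; - b t p 0 1 3%:R;
              b t p 0 1 2%:R] n).
  by elim/ord4_ind: n; rewrite /=; try apply: smooth_scalarN => //; exact: sb.
by apply/funext => t; apply/funext => p; rewrite mxE.
Qed.

Lemma smooth_Acoef k i : smooth_scalar J c (fun t p => Acoef t k p i).
Proof.
have sH := smooth_endo_mx; have sT := smooth_theta th openJ c.
have sQ j : smooth_mx J c (fun t p => quat (fun i => Hm t p j i)).
  by apply: smooth_quat => i'; exact: sH.
rewrite /Acoef /ad_solution; apply: smooth_scalarM => //.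
  apply: smooth_scalarV => //.
    move=> t p Jt cp; apply: mulf_neq0.
      by apply: mulf_neq0 => //; exact: triple_endo_mx_neq0.
    apply: mulf_neq0; first by rewrite invr_eq0 gt_eqF// sqrtr_gt0.
    by rewrite -unitfE -unitmxE; exact: theta_unit.
  apply: smooth_scalarM => //.
    apply: smooth_scalarM => //; first exact: smooth_scalar_cst.
    apply: eq_smooth_scalar (smooth_det openJ sH) => // t p _ _.
    by rewrite triple_det.
  apply: smooth_scalarM => //; first exact: smooth_scalar_cst.
  exact: smooth_det.
have sD j : smooth_mx J c (fun t p => dual3 (fun a l m => dGammaB t j a l m p)).
  by apply: smooth_dual3 => a l m; exact: smooth_dGammaB.
have sP j : smooth_mx J c (fun t p =>
    dual3 (fun a l m => dGammaB t j a l m p) *m (th c p)^T *m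
      (quat (fun i' => Hm t p i i') *m quat (fun i => Hm t p j i)) *m th c p).
  apply: smooth_mxM => //; apply: smooth_mxM => //; last exact: smooth_mxM.
  by apply: smooth_mxM => //; exact: smooth_mxT.
rewrite (_ : (fun _ _ => _) = fun t p => \sum_j
    (dual3 (fun a l m => dGammaB t j a l m p) *m (th c p)^T *m
      (quat (fun i' => Hm t p i i') *m quat (fun i => Hm t p j i)) *m th c p) 0 k).
  by apply: smooth_scalar_sum => // j; exact: sP.
by apply/funext => t; apply/funext => p; rewrite summxE.
Qed.

Lemma Acoef_eq t p i j l m : J t -> dom c p ->
  ad_coef (fun i => S t i p) (Acoef t ^~ p) i j l m = dGammaB t i j l m p.
Proof.
move=> Jt cp.
have SE : (fun i => S t i p) = fun i => sdform th c p (Hm t p i).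
  by apply/funext => i'; exact: ht_Sigma_sdform.
have := ad_solutionP th cp (triple_endo_mx_neq0 Jt cp) i j l m
  (fun i => dGammaB_alternating i Jt cp).
by rewrite SE.
Qed.

Lemma ad_inv_Acoef t k p : J t -> dom c p ->
  ad_inv th (ht t) c (dcov2 (GammaLC g c) (Bform th (ht t) c)) k p =
  sdform th c p (Acoef t k p).
Proof.
move=> Jt cp.
apply: (@ad_inv_sdform _ _ _ _ th c p cp (ht t) _ (fun k => Acoef t k p) k).
- exact: triple_endo_mx_neq0.
- by move=> i; exact: ht_Sigma_sdform.
move=> j l m; rewrite ad_sdform//.
rewrite (frame_dcov2 (be := Be t) j l m (@frame_connection_LC _ _ _ _ th c) cp)//.
  congr (sdform th c p _); apply/funext => i.
  exact: (Acoef_eq i j l m Jt cp).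
by move=> j' k' l' i; exact: (smooth_scalar_pderivable j' (smooth_Be k' l' i) Jt cp).
Qed.

Definition conn_coef t k p i : R := lc_coef th c k p i - Acoef t k p i.

Lemma smooth_conn_coef k i : smooth_scalar J c (fun t p => conn_coef t k p i).
Proof.
by apply: smooth_scalarB => //; [exact: smooth_lc_coef|exact: smooth_Acoef].
Qed.

Lemma frame_connection_Aconn t : J t ->
  frame_connection th c (Aconn th (ht t) c) (conn_coef t).
Proof.
move=> Jt; rewrite /conn_coef.
apply: (frame_connectionD (al := fun k p i => - Acoef t k p i)).
  exact: frame_connection_LC.
by move=> k p cp; rewrite ad_inv_Acoef// -sdformN.
Qed.

End Variation.

(** * The first variation of the connection *)

Section DerivativeHelpers.
Context (R : realType).
Implicit Types (f : R^o -> R^o) (t : R^o).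

Lemma is_derive_bigsum (I : Type) (s : seq I) (f : I -> R^o -> R^o) (df : I -> R^o) t :
  (forall i, is_derive t (1 : R^o) (f i) (df i)) ->
  is_derive t (1 : R^o) (fun u => \sum_(i <- s) f i u : R^o) (\sum_(i <- s) df i).
Proof.
move=> Df; elim: s => [|i s IH].
  rewrite big_nil (_ : (fun _ => _) = cst 0); first exact: is_derive_cst.
  by apply/funext => u; rewrite big_nil.
rewrite big_cons (_ : (fun _ => _) = f i + (fun u => \sum_(j <- s) f j u : R^o)).
  exact: (is_deriveD (Df i) IH).
by apply/funext => u; rewrite big_cons.
Qed.

Lemma is_derive_scale f (df : R^o) t (a : R) : is_derive t (1 : R^o) f df ->
  is_derive t (1 : R^o) (fun u => a * f u : R^o) (a * df).
Proof. by move=> Df; exact: (is_deriveZ a Df). Qed.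

Lemma is_derive_mul f1 f2 (d1 d2 : R^o) t : is_derive t (1 : R^o) f1 d1 ->
  is_derive t (1 : R^o) f2 d2 ->
  is_derive t (1 : R^o) (fun u => f1 u * f2 u : R^o) (d1 * f2 t + f1 t * d2).
Proof.
move=> D1 D2; apply: is_derive_eq (is_deriveM D1 D2) _.
by rewrite addrC [X in X + _](mulrC (f2 t)).
Qed.

Context (M : topologicalType) (X : oriented_atlas R M).
Context (g : riemannian_metric X) (th : coframe g).

Lemma is_derive_sdform c p (x : R -> 'I_3 -> R) (dx : 'I_3 -> R) t :
  (forall i, is_derive t (1 : R^o) (fun u : R^o => x u i : R^o) (dx i)) ->
  is_derive t (1 : R^o) (fun u : R^o => sdform th c p (x u)) (sdform th c p dx).
Proof.
move=> Dx; apply: is_derive_mx => a b.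
have E y : sdform th c p y a b = \sum_(i < 3) Sigma th c p i a b * y i.
  by rewrite /sdform summxE; apply: eq_bigr => i _; rewrite mxE mulrC.
rewrite E (_ : (fun _ => _) =
    fun u : R^o => \sum_(i < 3) Sigma th c p i a b * x u i : R^o).
  by apply: is_derive_bigsum => i; exact: is_derive_scale.
by apply/funext => u; rewrite E.
Qed.

Lemma sd_partN c p (T : 'I_4 -> 'I_4 -> R^o) k l :
  sd_part g c p (fun a b => - T a b : R^o) k l = - sd_part g c p T k l.
Proof.
rewrite /sd_part -scalerN opprD; congr (_ *: (_ + _)).
rewrite /hodge -sumrN; apply: eq_bigr => m _; rewrite -sumrN.
apply: eq_bigr => n _; rewrite -scalerN -sumrN; congr (_ *: _).
apply: eq_bigr => a _; rewrite -sumrN; apply: eq_bigr => b _.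
by rewrite scalerN.
Qed.

Lemma is_derive_sd_part c p (T : R -> 'I_4 -> 'I_4 -> R) (dT : 'I_4 -> 'I_4 -> R) t k l :
  (forall a b, is_derive t (1 : R^o) (fun u : R^o => T u a b : R^o) (dT a b)) ->
  is_derive t (1 : R^o)
    (fun u : R^o => sd_part g c p (fun a b => T u a b : R^o) k l)
    (sd_part g c p (fun a b => dT a b : R^o) k l).
Proof.
move=> DT.
have Dh : is_derive t (1 : R^o)
    (fun u : R^o => hodge g c p (fun a b => T u a b : R^o) k l)
    (hodge g c p (fun a b => dT a b : R^o) k l).
  do 2![apply: is_derive_bigsum => ?]; apply: is_derive_scale.
  by do 2![apply: is_derive_bigsum => ?]; apply: is_derive_scale; exact: DT.
exact: (is_derive_scale 2^-1 (is_deriveD (DT k l) Dh)).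
Qed.

Lemma form_endo_sdform c p (T : 'I_4 -> 'I_4 -> 'I_3 -> R) y : dom c p ->
  form_endo g c p (sd_part g c p (fun k l => sdform th c p (T k l))) (sdform th c p y) =
  \matrix_(k, l) \sum_i sd_part g c p (fun a b => T a b i : R^o) k l * y i.
Proof.
move=> cp; apply/matrixP => k l; rewrite !mxE.
have -> : sd_part g c p (fun k l => sdform th c p (T k l)) k l =
    sdform th c p (fun i => sd_part g c p (fun a b => T a b i : R^o) k l).
  have sdform_sum (I : finType) (f : I -> 'I_3 -> R) :
      \sum_i sdform th c p (f i) = sdform th c p (fun j => \sum_i f i j).
    rewrite /sdform exchange_big /=; apply: eq_bigr => j _.
    by rewrite scaler_suml.
  rewrite /sd_part /hodge.
  under eq_bigr do under eq_bigr do under eq_bigr do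
    under eq_bigr do rewrite -sdformZ.
  under eq_bigr do under eq_bigr do under eq_bigr do rewrite sdform_sum.
  under eq_bigr do under eq_bigr do rewrite sdform_sum -sdformZ.
  under eq_bigr do rewrite sdform_sum.
  by rewrite sdform_sum -sdformD -sdformZ.
by rewrite ip_sdform.
Qed.

End DerivativeHelpers.

Section FirstVariation.
Context (R : realType) (M : topologicalType) (X : oriented_atlas R M).
Context (g : riemannian_metric X) (th : coframe g).
Context (J : set R) (openJ : open J) (J0 : J 0) (ht : R -> endo_field X).
Context (ht_pos : forall t, J t -> Omega0_Sym2_pos g (ht t)).
Context (ht_smooth : smooth_variation g J ht) (c : chart_idx X).
Implicit Types (t : R) (p : M).

Let eta := dot0 ht.
Let S t i p := ht t c p (Sigma th c p i).
Let Hm t p := endo_mx th (ht t) c p.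
Let Be t (l m : 'I_4) p : 'I_3 -> R := fun i => S t i p l m.
Let al := Acoef th ht c.
Let w := conn_coef th ht c.

Definition dBcoef (l m : 'I_4) p : 'I_3 -> R := fun i =>
  time_der (fun t q => Be t l m q i) 0 p.
Definition dAcoef k p : 'I_3 -> R := fun i => time_der (fun t q => al t k q i) 0 p.
Definition dendo_mx p : 'M[R]_3 := \matrix_(j, i) time_der (fun t q => Hm t q j i) 0 p.

Let sBe l m i : smooth_scalar J c (fun t p => Be t l m p i).
Proof. exact: (smooth_ht_Sigma th openJ ht_smooth c i). Qed.

Let sAl k i : smooth_scalar J c (fun t p => al t k p i).
Proof. exact: (smooth_Acoef th openJ ht_pos ht_smooth c k i). Qed.

Let sw k i : smooth_scalar J c (fun t p => w t k p i).
Proof. exact: (smooth_conn_coef th openJ ht_pos ht_smooth c k i). Qed.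

Let sHm j i : smooth_scalar J c (fun t p => Hm t p j i).
Proof. exact: (smooth_endo_mx th openJ ht_smooth c j i). Qed.

Let near_J (P : R -> Prop) : (forall t, J t -> P t) -> \forall t \near (0 : R^o), P t.
Proof. by move=> JP; apply: filterS (open_nbhs_nbhs (conj openJ J0)). Qed.

Lemma dot0_Sigma p i : dom c p ->
  eta c p (Sigma th c p i) = \matrix_(l, m) dBcoef l m p i.
Proof.
move=> cp; have D : is_derive (0 : R^o) (1 : R^o) (fun t : R^o => S t i p)
    (\matrix_(l, m) dBcoef l m p i).
  apply: is_derive_mx => l m; rewrite mxE.
  exact: (smooth_scalar_is_derive (sBe l m i) J0 cp).
exact: (@derive_val _ _ _ _ _ _ _ D).
Qed.

(** Proved through the matrices of [h(t)], since the derivative of a family of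
    endomorphisms is not known beforehand to be linear. *)
Lemma dot0_sdform p x : dom c p ->
  eta c p (sdform th c p x) = sdform th c p (fun i => ((\row_j x j) *m dendo_mx p) 0 i).
Proof.
move=> cp; have D : is_derive (0 : R^o) (1 : R^o)
    (fun t : R^o => sdform th c p (fun i => ((\row_j x j) *m Hm t p) 0 i))
    (sdform th c p (fun i => ((\row_j x j) *m dendo_mx p) 0 i)).
  apply: is_derive_sdform => i; rewrite mxE.
  rewrite (_ : (fun _ => _) = fun t : R^o => \sum_j (\row_j x j) 0 j * Hm t p j i : R^o).
    apply: is_derive_bigsum => j; rewrite [dendo_mx p j i]mxE.
    by apply: is_derive_scale; exact: (smooth_scalar_is_derive (sHm j i) J0 cp).
  by apply/funext => t; rewrite mxE.
rewrite -(@derive_val _ _ _ _ _ _ _ D); apply: near_eq_derive.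
by apply: near_J => t Jt; rewrite endo_sdform//; have [[]] := ht_pos Jt.
Qed.

Lemma time_der_crossv (x y : R -> M -> 'I_3 -> R) i p :
  (forall i, smooth_scalar J c (fun t p => x t p i)) ->
  (forall i, smooth_scalar J c (fun t p => y t p i)) -> dom c p ->
  time_der (fun t q => crossv (x t q) (y t q) i) 0 p =
  crossv (fun i => time_der (fun t q => x t q i) 0 p) (y 0 p) i
  + crossv (x 0 p) (fun i => time_der (fun t q => y t q i) 0 p) i.
Proof.
move=> sx sy cp; rewrite /crossv.
have sM j l := smooth_scalarM openJ (sx j) (sy l).
rewrite (time_derB (sM _ _) (sM _ _) J0 cp).
rewrite !(time_derM (sx _) (sy _) J0 cp); ring.
Qed.

(** The Levi-Civita form is constant in time and time derivatives commute
    with partial ones. *)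
Lemma time_der_dGammaB i j l m p : dom c p ->
  time_der (fun t q => dGammaB th ht c t i j l m q) 0 p =
  d2_coef c (lc_coef th c) dBcoef j l m p i.
Proof.
move=> cp.
have slc k i' : smooth_scalar J c (fun _ q => lc_coef th c k q i').
  exact: smooth_lc_coef.
pose Y j l m t q := pder c j (fun q => Be t l m q i) q + crossv (lc_coef th c j q) (Be t l m q) i.
have sP j' l' m' := smooth_scalar_pder openJ j' (sBe l' m' i).
have sC j' l' m' := smooth_crossv openJ i (slc j') (sBe l' m').
have sY j' l' m' : smooth_scalar J c (Y j' l' m').
  exact: (smooth_scalarD openJ (sP j' l' m') (sC j' l' m')).
have dY j' l' m' : time_der (Y j' l' m') 0 p =
    pder c j' (fun q => dBcoef l' m' q i) p + crossv (lc_coef th c j' p) (dBcoef l' m' p) i.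
  rewrite (time_derD (sP j' l' m') (sC j' l' m') J0 cp).
  rewrite (time_der_pder openJ j' (sBe l' m' i) J0 cp).
  rewrite (time_der_crossv i (slc j') (sBe l' m') cp).
  congr (_ + _); rewrite /crossv !time_der_cst !mul0r subr0 add0r.
  by [].
have -> : time_der (fun t q => dGammaB th ht c t i j l m q) 0 p =
    time_der (fun t q => Y j l m t q + Y l m j t q + Y m j l t q) 0 p by [].
rewrite (time_derD (smooth_scalarD openJ (sY _ _ _) (sY _ _ _)) (sY _ _ _) J0 cp).
by rewrite (time_derD (sY _ _ _) (sY _ _ _) J0 cp) !dY.
Qed.

Lemma ad_coefE (S' : 'I_3 -> 'M[R]_4) (a : 'I_4 -> 'I_3 -> R) i j l m :
  ad_coef S' a i j l m = crossv (a j) (fun i => S' i l m) i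
    + crossv (a l) (fun i => S' i m j) i + crossv (a m) (fun i => S' i j l) i.
Proof. by rewrite /ad_coef /wedge12 /crossv !mxE; ring. Qed.

(** Differentiate [[a, B_h] = d_Gamma B_h], where [a = Gamma - A(h)], to get
    [[a', B_h] = d_Gamma B_eta - [a, B_eta]]; the right-hand side is
    [d_A B_eta]. *)
Lemma dAcoef_eq i j l m p : dom c p ->
  ad_coef (fun i => S 0 i p) (fun k => dAcoef k p) i j l m =
  d2_coef c (w 0) dBcoef j l m p i.
Proof.
move=> cp.
have sC j' l' m' := smooth_crossv openJ i (sAl j') (sBe l' m').
pose F t q := crossv (al t j q) (Be t l m q) i + crossv (al t l q) (Be t m j q) i
  + crossv (al t m q) (Be t j l q) i.
have FE : time_der F 0 p = time_der (fun t q => dGammaB th ht c t i j l m q) 0 p.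
  apply: (eq_time_der openJ) => // t Jt.
  by rewrite -(Acoef_eq th openJ ht_pos ht_smooth i j l m Jt cp) ad_coefE.
move: FE; rewrite time_der_dGammaB//.
rewrite (time_derD (smooth_scalarD openJ (sC _ _ _) (sC _ _ _)) (sC _ _ _) J0 cp).
rewrite (time_derD (sC _ _ _) (sC _ _ _) J0 cp).
rewrite !(time_der_crossv i (sAl _) (sBe _ _) cp) => E.
rewrite ad_coefE; move: E; rewrite /d2_coef.
have cw k y : crossv (w 0 k p) y i =
    crossv (lc_coef th c k p) y i - crossv (al 0 k p) y i.
  by rewrite /crossv /w /conn_coef -/al; ring.
(* x: [a', B_h], y: [a, B_eta], d: the partial derivatives of B_eta,
   g: [Gamma, B_eta], one term for each cyclic permutation of j, l, m *)
have lem (x1 x2 x3 y1 y2 y3 d1 d2 d3 g1 g2 g3 : R) :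
    x1 + y1 + (x2 + y2) + (x3 + y3) = d1 + g1 + (d2 + g2) + (d3 + g3) ->
    x1 + x2 + x3 = d1 + (g1 - y1) + (d2 + (g2 - y2)) + (d3 + (g3 - y3)) by lra.
by rewrite !cw => /lem; exact.
Qed.

Lemma ad_inv_dBE k p : dom c p ->
  ad_inv_dB th (ht 0) eta c k p = sdform th c p (dAcoef k p).
Proof.
move=> cp.
apply: (@ad_inv_sdform _ _ _ _ th c p cp (ht 0) _ (fun k => dAcoef k p) k).
- exact: (triple_endo_mx_neq0 th ht_pos J0 cp).
- by move=> i; exact: (ht_Sigma_sdform th ht_pos i J0 cp).
move=> j l m; rewrite ad_sdform//.
have LC : frame_connection th c (Aconn th (ht 0) c) (w 0).
  exact: (frame_connection_Aconn openJ ht_pos ht_smooth J0).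
rewrite (frame_dcov2 (be := dBcoef) j l m LC cp)//.
- by congr (sdform th c p _); apply/funext => i; exact: dAcoef_eq.
- move=> a b q cq; rewrite Bform_sdform; congr (sdform th c q _).
  by apply/funext => i; rewrite dot0_Sigma// mxE.
- move=> j' a b i.
  exact: (smooth_scalar_pderivable j' (smooth_scalar_time_der openJ (sBe a b i)) J0 cp).
Qed.

Lemma conn_derivative_Aconn :
  conn_derivative th c (fun t => Aconn th (ht t) c)
    (fun k p => - ad_inv_dB th (ht 0) eta c k p).
Proof.
move=> k p v cp sv; have vE : v p = sdform th c p (sdcoef th c p (v p)).
  by apply: LambdaP_sdformE => //; exact: sv.1.
move: (sdcoef th c p (v p)) vE => y vE.
have D : is_derive (0 : R^o) (1 : R^o) (fun t : R^o =>
    GammaLC g c k v p + sdform th c p (crossv (fun i => - al t k p i) y))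
    (0 + sdform th c p (crossv (fun i => - dAcoef k p i) y)).
  apply: is_deriveD; apply: is_derive_sdform => i.
  have Da j : is_derive (0 : R^o) (1 : R^o) (fun t : R^o => - al t k p j : R^o)
      (- dAcoef k p j).
    exact: (is_deriveN (smooth_scalar_is_derive (sAl k j) J0 cp)).
  have D1 := is_derive_scale (y (i + 2%:R)) (Da (i + 1)).
  have D2 := is_derive_scale (y (i + 1)) (Da (i + 2%:R)).
  rewrite /crossv !(mulrC _ (y _)).
  rewrite (_ : (fun _ => _) = fun t : R^o =>
      (y (i + 2%:R) * - al t k p (i + 1) - y (i + 1) * - al t k p (i + 2%:R) : R^o)).
    exact: (is_deriveB D1 D2).
  by apply/funext => t; rewrite !(mulrC _ (y _)).
rewrite add0r in D; rewrite ad_inv_dBE// -sdformN vE cross_sdform//.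
(* outside J the family is arbitrary; only times near 0 matter *)
apply: near_eq_is_derive D; apply: near_J => t Jt.
have aE := ad_inv_Acoef th openJ ht_pos ht_smooth k Jt cp.
by rewrite /Aconn /conn_add aE -sdformN vE cross_sdform.
Qed.

Let K t (k l : 'I_4) p := curv_coef c (w t) k l p.

Lemma curvature_Aconn t k l p : J t -> dom c p ->
  curvature th c (Aconn th (ht t) c) k l p = sdform th c p (K t k l p).
Proof.
move=> Jt cp; apply: frame_curvature => //.
  exact: (frame_connection_Aconn openJ ht_pos ht_smooth Jt).
by move=> k' i; apply: (smooth_scalar_field openT); exact: (smooth_scalar_slice Jt (sw k' i)).
Qed.

Let time_der_w k i p : dom c p ->
  time_der (fun t q => w t k q i) 0 p = - dAcoef k p i.
Proof.
move=> cp; have slc := smooth_lc_coef th openJ c k i.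
rewrite (time_derB slc (sAl k i) J0 cp).
by rewrite (time_der_cst (fun q => lc_coef th c k q i)) sub0r.
Qed.

(** The usual first variation [d_A A'] of the curvature, with [A'] equal to
    minus the form with coefficients [dAcoef]. *)
Lemma curv_is_derive k l p i : dom c p ->
  is_derive (0 : R^o) (1 : R^o) (fun t : R^o => K t k l p i : R^o)
    (- d1_coef c (w 0) dAcoef k l p i).
Proof.
move=> cp.
have sP k' l' := smooth_scalar_pder openJ k' (sw l' i).
have sC := smooth_crossv openJ i (sw k) (sw l).
have sPP := smooth_scalarB openJ (sP k l) (sP l k).
have sK : smooth_scalar J c (fun t q => K t k l q i) := smooth_scalarD openJ sPP sC.
have dP k' l' : time_der (fun t q => pder c k' (fun q => w t l' q i) q) 0 p =
    - pder c k' (fun q => dAcoef l' q i) p.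
  rewrite (time_der_pder openJ k' (sw l' i) J0 cp).
  rewrite (eq_pder k' (f' := fun q => - dAcoef l' q i))//; last first.
    by move=> q cq; exact: time_der_w.
  rewrite pderN//.
  exact: (smooth_scalar_pderivable k' (smooth_scalar_time_der openJ (sAl l' i)) J0 cp).
apply: is_derive_eq (smooth_scalar_is_derive sK J0 cp) _.
rewrite (time_derD sPP sC J0 cp) (time_derB (sP _ _) (sP _ _) J0 cp) !dP.
rewrite (time_der_crossv i (sw k) (sw l) cp) /d1_coef /crossv !time_der_w//.
ring.
Qed.

End FirstVariation.

(** * The first variation of Phi *)

Section PhiVariation.
Context (R : realType) (M : topologicalType) (X : oriented_atlas R M).
Context (g : riemannian_metric X) (th : coframe g).
Context (J : set R) (openJ : open J) (J0 : J 0) (ht : R -> endo_field X).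
Context (ht_pos : forall t, J t -> Omega0_Sym2_pos g (ht t)).
Context (ht_smooth : smooth_variation g J ht) (c : chart_idx X).
Context (p : M) (cp : dom c p).
Implicit Types (t : R).

Let h := ht 0.
Let eta := dot0 ht.
Let Hm t := endo_mx th (ht t) c p.
Let w := conn_coef th ht c.
Let K t (k l : 'I_4) := curv_coef c (w t) k l p.
Let d1 (k l : 'I_4) := d1_coef c (w 0) (dAcoef th ht c) k l p.

Lemma FplusA_sdform t y : J t -> FplusA th (ht t) c p (sdform th c p y) =
  \matrix_(k, l) \sum_i sd_part g c p (fun a b => K t a b i : R^o) k l * y i.
Proof.
move=> Jt; have E : (fun k l => curvature th c (Aconn th (ht t) c) k l p) =
    fun k l => sdform th c p (K t k l).
  apply/funext => k; apply/funext => l.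
  exact: (curvature_Aconn th openJ ht_pos ht_smooth k l Jt cp).
by rewrite /FplusA E (form_endo_sdform th (K t) y cp).
Qed.

Lemma dplus_ad_inv_dB_sdform y : dplus_ad_inv_dB th h eta c p (sdform th c p y) =
  \matrix_(k, l) \sum_i sd_part g c p (fun a b => d1 a b i : R^o) k l * y i.
Proof.
have E : (fun k l => dcov1 (Aconn th h c) (ad_inv_dB th h eta c) k l p) =
    fun k l => sdform th c p (d1 k l); last first.
  by rewrite /dplus_ad_inv_dB E (form_endo_sdform th d1 y cp).
apply/funext => k; apply/funext => l.
have LC : frame_connection th c (Aconn th h c) (w 0).
  exact: (frame_connection_Aconn openJ ht_pos ht_smooth J0).
apply: (frame_dcov1 k l LC cp).
  by move=> k' q cq; exact: (ad_inv_dBE th openJ J0 ht_pos ht_smooth k' cq).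
move=> k' l' i.
have sA := smooth_Acoef th openJ ht_pos ht_smooth c l' i.
exact: (smooth_scalar_pderivable k' (smooth_scalar_time_der openJ sA) J0 cp).
Qed.

Section Vector.
Context (y0 : 'I_3 -> R).

Let Y t i : R := ((\row_j y0 j) *m invmx (Hm t)) 0 i.
Let dY i : R := - ((\row_j Y 0 j) *m dendo_mx th ht c p *m invmx (Hm 0)) 0 i.

(** Differentiate [Y(t) h(t) = y0]. *)
Lemma inv_is_derive i :
  is_derive (0 : R^o) (1 : R^o) (fun t : R^o => Y t i : R^o) (dY i).
Proof.
pose YY t q i := ((\row_j y0 j) *m invmx (endo_mx th (ht t) c q)) 0 i.
have sI := smooth_inv_endo_mx th openJ ht_pos ht_smooth c.
have sH := smooth_endo_mx th openJ ht_smooth c.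
have sY j : smooth_scalar J c (fun t q => YY t q j).
  apply: (smooth_mxM openJ (A := fun _ _ => \row_j y0 j)) => //.
  by move=> a b; exact: smooth_scalar_cst.
apply: is_derive_eq (smooth_scalar_is_derive (sY i) J0 cp) _.
pose dy i := time_der (fun t q => YY t q i) 0 p.
have uH t : J t -> Hm t \in unitmx by move=> /ht_pos; exact: endo_mx_unit.
have E : \row_j dy j *m Hm 0 = - (\row_j Y 0 j *m dendo_mx th ht c p).
  apply/rowP => l; rewrite [LHS]mxE [RHS]mxE [X in - X]mxE.
  apply/eqP; rewrite -addr_eq0 -big_split /=; apply/eqP.
  have sM j := smooth_scalarM openJ (sY j) (sH j l).
  transitivity (time_der (fun t q => \sum_j YY t q j * endo_mx th (ht t) c q j l) 0 p).
    rewrite (time_der_sum openJ _ sM J0 cp); apply: eq_bigr => j _.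
    by rewrite (time_derM (sY j) (sH j l) J0 cp) [dendo_mx _ _ _ _ _ _]mxE;
      congr (_ * _ + _ * _); rewrite mxE.
  apply: etrans (time_der_cst (fun=> y0 l) 0 p).
  apply: (eq_time_der openJ) => // t Jt.
  have := congr1 (fun A : 'rV[R]_3 => A 0 l) (mulmxKV (uH t Jt) (\row_j y0 j)).
  by rewrite !mxE.
have := congr1 (fun A : 'rV[R]_3 => (A *m invmx (Hm 0)) 0 i) E.
by rewrite mulmxK ?uH// mulNmx mxE => dyE; apply: etrans dyE _; rewrite mxE.
Qed.

Lemma Phi_is_derive_sdform (v := sdform th c p y0) :
  is_derive (0 : R^o) (1 : R^o) (fun t : R^o => Phi th (ht t) c p v)
    (- dplus_ad_inv_dB th h eta c p (endo_inv g h c p v)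
     - FplusA th h c p (endo_inv g h c p (eta c p (endo_inv g h c p v)))).
Proof.
have invE t : J t -> endo_inv g (ht t) c p v = sdform th c p (Y t).
  by move=> /ht_pos; exact: endo_inv_sdform.
have D : is_derive (0 : R^o) (1 : R^o) (fun t : R^o =>
    \matrix_(k, l) (\sum_i sd_part g c p (fun a b => K t a b i : R^o) k l * Y t i))
    (\matrix_(k, l) (\sum_i
      (sd_part g c p (fun a b => - d1 a b i : R^o) k l * Y 0 i +
       sd_part g c p (fun a b => K 0 a b i : R^o) k l * dY i))).
  apply: is_derive_mx => k l; rewrite mxE.
  rewrite (_ : (fun _ => _) = fun t : R^o =>
      \sum_i sd_part g c p (fun a b => K t a b i : R^o) k l * Y t i : R^o).
    apply: is_derive_bigsum => i; apply: is_derive_mul; last exact: inv_is_derive.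
    apply: is_derive_sd_part => a b.
    exact: (curv_is_derive th openJ J0 ht_pos ht_smooth a b i cp).
  by apply/funext => t; rewrite mxE.
rewrite (invE _ J0) /eta (dot0_sdform th openJ J0)// endo_inv_sdform//; last exact: ht_pos.
rewrite dplus_ad_inv_dB_sdform FplusA_sdform//.
have D' := is_deriveB D (is_derive_cst v (0 : R^o) (1 : R^o)).
rewrite subr0 in D'.
apply: is_derive_eq (near_eq_is_derive _ D') _.
  apply: filterS (open_nbhs_nbhs (conj openJ J0)) => t Jt.
  by rewrite /Phi invE// FplusA_sdform.
apply/matrixP => k l; rewrite !mxE -!sumrN -big_split /=; apply: eq_bigr => i _.
have rowE (r : 'rV[R]_3) : \row_j r 0 j = r by apply/rowP => j; rewrite mxE.
by rewrite (sd_partN g c p (fun a b => d1 a b i)) mulNr rowE mulrN.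
Qed.

End Vector.
End PhiVariation.

Theorem lemma2p14 (R : realType) (M : topologicalType)
    (X : oriented_atlas R M) (g : riemannian_metric X) (th : coframe g)
    (hausdorffM : hausdorff_space M) (compactM : compact [set: M])
    (connectedM : connected [set: M])
    (J : set R) (openJ : open J) (intervalJ : is_interval J) (J0 : J 0)
    (ht : R -> endo_field X)
    (ht_pos : forall t, J t -> Omega0_Sym2_pos g (ht t))
    (ht_smooth : smooth_variation g J ht) :
  let h := ht 0 in
  let eta := dot0 ht in
  (forall c, conn_derivative th c (fun t => Aconn th (ht t) c)
     (fun k p => - ad_inv_dB th h eta c k p)) /\
  endo_derivative g (fun t => Phi th (ht t))
    (fun c p v =>
       - dplus_ad_inv_dB th h eta c p (endo_inv g h c p v)
       - FplusA th h c p
           (endo_inv g h c p (eta c p (endo_inv g h c p v)))) /\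
  ((forall c p v, dom c p -> LambdaP g c p v -> Phi th h c p v = 0) ->
   endo_derivative g (fun t => Phi th (ht t))
     (fun c p v =>
        - dplus_ad_inv_dB th h eta c p (endo_inv g h c p v)
        - eta c p (endo_inv g h c p v))).
Proof.
move=> h eta.
have DPhi : endo_derivative g (fun t => Phi th (ht t))
    (fun c p v =>
       - dplus_ad_inv_dB th h eta c p (endo_inv g h c p v)
       - FplusA th h c p
           (endo_inv g h c p (eta c p (endo_inv g h c p v)))).
  move=> c p v cp Lv; rewrite (LambdaP_sdformE th cp Lv).
  exact: (Phi_is_derive_sdform th openJ J0 ht_pos ht_smooth cp).
split.
  by move=> c; exact: (conn_derivative_Aconn th openJ J0 ht_pos ht_smooth).
split=> // Phi0 c p v cp Lv; apply: is_derive_eq (DPhi c p v cp Lv) _.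
congr (_ - _); apply/eqP; rewrite -subr_eq0; apply/eqP; apply: Phi0 => //.
rewrite (LambdaP_sdformE th cp Lv) endo_inv_sdform//; last exact: ht_pos.
by rewrite /eta (dot0_sdform th openJ J0)//; exact: LambdaP_sdform.
Qed.
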